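(* Fix $\beta,n\in\mathbb{N}$. For every $s\in\mathbb{C}$ with $\operatorname{Re}(s)=1$, the series $\sum_{q=1}^\infty c_q^{(\beta)}(n)q^{-s}$ converges and $$\sum_{q=1}^\infty\frac{c_q^{(\beta)}(n)}{q^s}=\frac{\sigma^{(\beta)}_{1-s/\beta}(n)}{\zeta(s)},$$ where at $s=1$ the right-hand side is interpreted as $0$ (since $\zeta$ has a pole there).
   Context: For $\beta,q,n\in\mathbb{N}$, $c_q^{(\beta)}(n)=\sum e^{2\pi i nh/q^\beta}$, the sum over integers $0\le h<q^\beta$ such that $h$ and $q^\beta$ have no common divisor of the form $d^\beta$ with $d>1$. For $z\in\mathbb{C}$, $\sigma_z^{(\beta)}(n)=\sum_{d\in\mathbb{N},\ d^\beta\mid n}d^{\beta z}$. *)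

(* Defs.v *)
From Stdlib Require Import Reals List Arith.
Open Scope R_scope.

Definition Cplx := (R * R)%type.
Definition RtoC (x : R) : Cplx := (x, 0).
Definition Czero : Cplx := (0, 0).
Definition Cone : Cplx := (1, 0).
Definition Cadd (a b : Cplx) : Cplx := (fst a + fst b, snd a + snd b).
Definition Csub (a b : Cplx) : Cplx := (fst a - fst b, snd a - snd b).
Definition Copp (a : Cplx) : Cplx := (- fst a, - snd a).
Definition Cmul (a b : Cplx) : Cplx :=
  (fst a * fst b - snd a * snd b, fst a * snd b + snd a * fst b).
Definition Cinv (a : Cplx) : Cplx :=
  let d := fst a * fst a + snd a * snd a in (fst a / d, - snd a / d).
Definition Cdiv (a b : Cplx) : Cplx := Cmul a (Cinv b).

Definition Cexpi (theta : R) : Cplx := (cos theta, sin theta).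

Definition Cpow (x : R) (z : Cplx) : Cplx :=
  (exp (fst z * ln x) * cos (snd z * ln x), exp (fst z * ln x) * sin (snd z * ln x)).

Definition Csum (l : list nat) (f : nat -> Cplx) : Cplx :=
  fold_right (fun k acc => Cadd (f k) acc) Czero l.

Definition Cseq_cv (u : nat -> Cplx) (L : Cplx) : Prop :=
  Un_cv (fun N => fst (u N)) (fst L) /\ Un_cv (fun N => snd (u N)) (snd L).

Definition Cseries_cv (a : nat -> Cplx) (L : Cplx) : Prop :=
  Cseq_cv (fun N => Csum (seq 1 N) a) L.

(* h and q^beta have no common divisor of the form d^beta with d > 1.
   For beta >= 1, q >= 1, such a d satisfies d <= d^beta <= q^beta,
   so checking d in 2 .. q^beta+1 covers all candidates. *)
Definition beta_coprime (beta q h : nat) : bool :=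
  forallb (fun d => negb (Nat.eqb (h mod d ^ beta) 0 && Nat.eqb (q ^ beta mod d ^ beta) 0))
          (seq 2 (q ^ beta)).

Definition ramanujan_c (beta q n : nat) : Cplx :=
  Csum (filter (beta_coprime beta q) (seq 0 (q ^ beta)))
       (fun h => Cexpi (2 * PI * INR n * INR h / INR (q ^ beta))).

(* sigma_z^{(beta)}(n) = sum_{d >= 1, d^beta | n} d^{beta z};
   for n >= 1 such d satisfy d <= d^beta <= n (beta >= 1). *)
Definition sigma_beta (beta : nat) (z : Cplx) (n : nat) : Cplx :=
  Csum (filter (fun d => Nat.eqb (n mod d ^ beta) 0) (seq 1 n))
       (fun d => Cpow (INR d) (Cmul (RtoC (INR beta)) z)).

(* Riemann zeta on Re s > 0, s <> 1 (analytic continuation), via the classical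
   formula zeta(s) = lim_N ( sum_{k=1}^N k^{-s} - N^{1-s}/(1-s) ). *)
Definition is_zeta (s z : Cplx) : Prop :=
  Cseq_cv (fun N => Csub (Csum (seq 1 N) (fun k => Cpow (INR k) (Copp s)))
                         (Cdiv (Cpow (INR N) (Csub Cone s)) (Csub Cone s))) z.

(* Main.v *)
(* Write mu for the Moebius function and M(N) for its partial sums.  Since
   c_q(n) is the sum of mu(q/d) d^beta over the d | q with d^beta | n, the
   partial sums of the series are a finite combination, with coefficients
   d^(beta - s), of partial sums of sum mu(m) m^(-s).  It remains to show that
   the latter converge to 1/zeta(s), which for Re s = 1 has the strength of the
   prime number theorem.

   M(N) = o(N) is obtained in the manner of Selberg and Erdos.  Differentiating
   mu * 1 = unit twice gives mu ln^2 = mu * (Lambda * Lambda - Lambda ln), so by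
   Selberg's formula for Lambda * Lambda + Lambda ln, |M(N)|/N is at most a
   weighted logarithmic mean of |M(n)|/n, up to an error O(1/ln N).  As
   sum M(n)/(n(n+1)) has bounded partial sums and M moves by unit steps, M(n)/n
   is small on a positive proportion of every window [p, Lp), so this mean is
   smaller than limsup |M(n)|/n by a definite amount unless the limsup is 0.

   Expanding sum_(n <= N) mu(n) n^(-s) sum_(j <= N/n) j^(-s) = 1 with
   sum_(j <= y) j^(-s) = zeta(s) + y^(1-s)/(1-s) + O(1/y), and using Axer's
   argument to control the error, gives
   1 = zeta(s) m_s(N) + N^(1-s)/(1-s) m_1(N) + o(1) for the partial sums m_s of
   sum mu(n) n^(-s).  As m_1(N) = o(1), both zeta(s) <> 0 and
   m_s(N) -> 1/zeta(s) follow. *)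
Require Import Defs.
From Stdlib Require Import Reals List Arith.
Open Scope R_scope.
From Stdlib Require Lra Lia.
From HB Require structures.
From mathcomp Require all_boot zify.

(** Information on [M] alone does not make [m_s(N)] converge: after partial summation, [M(n) = o(n)]
    leaves terms of size [o(1/n)]. What it does give is that [m_s] changes by [o(1)] between [N/K]
    and [N] for fixed [K] ([musum_block]). The last step is arranged around this: Axer's argument
    uses only such blocks, the range [n <= N/K] costs a relative error [O(1/K)], and the limit is
    read off from an exact identity.

    The inequality for [|M(N)|/N] has weights of total mass close to 1, so by itself it gains
    nothing. The gain found in the windows must be uniform: [window_saving] and [log_mean_saving]
    produce a [k] that depends only on a threshold [a] and serves every bound [al >= a], so finitely
    many rounds lower the bound from 1 to any given [e].

    Selberg's formula is reached without explicit constants: those in the expansions of sums of [ln]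
    and [ln^2] come as limits from [cv_of_telescope], because an error [O(sqrt k)] survives
    summation over [k = N %/ d]. *)

Module RamanujanSeries.
Import Lra Lia HB.structures all_boot zify.
Delimit Scope R_scope with R.
Set Implicit Arguments.
Unset Strict Implicit.
Unset Printing Implicit Defensive.

HB.instance Definition _ :=
  Monoid.isComLaw.Build R 0 Rplus
    (fun x y z => Logic.eq_sym (Rplus_assoc x y z)) Rplus_comm Rplus_0_l.
HB.instance Definition _ := Monoid.isMulLaw.Build R 0 Rmult Rmult_0_l Rmult_0_r.
HB.instance Definition _ :=
  Monoid.isAddLaw.Build R Rmult Rplus Rmult_plus_distr_r Rmult_plus_distr_l.

Notation "\sum_ ( m <= i < n ) F" := (\big[Rplus/0]_(m <= i < n) F) : R_scope.
Notation "\sum_ ( m <= i < n | P ) F" :=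
  (\big[Rplus/0]_(m <= i < n | P%B) F) : R_scope.

(** * Finite sums *)

Lemma sum_recr (F : nat -> R) (n : nat) :
  \sum_(1 <= i < n.+2) F i = \sum_(1 <= i < n.+1) F i + F n.+1.
Proof. by rewrite big_nat_recr. Qed.

Lemma sum_distrl (a b : nat) (P : pred nat) (F : nat -> R) (c : R) :
  \sum_(a <= i < b | P i) (c * F i) = c * \sum_(a <= i < b | P i) F i.
Proof. by rewrite big_distrr. Qed.

Lemma sum_opp (a b : nat) (P : pred nat) (F : nat -> R) :
  \sum_(a <= i < b | P i) (- F i) = - \sum_(a <= i < b | P i) F i.
Proof. by rewrite (big_morph Ropp Ropp_plus_distr Ropp_0). Qed.

Lemma sum_add (a b : nat) (P : pred nat) (F G : nat -> R) :
  \sum_(a <= i < b | P i) (F i + G i) =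
  \sum_(a <= i < b | P i) F i + \sum_(a <= i < b | P i) G i.
Proof. by rewrite big_split. Qed.

Lemma sum_sub (a b : nat) (P : pred nat) (F G : nat -> R) :
  \sum_(a <= i < b | P i) (F i - G i) =
  \sum_(a <= i < b | P i) F i - \sum_(a <= i < b | P i) G i.
Proof. by rewrite /Rminus sum_add sum_opp. Qed.

Lemma sum_le (a b : nat) (F G : nat -> R) :
  (forall i, (a <= i < b)%N -> F i <= G i) ->
  \sum_(a <= i < b) F i <= \sum_(a <= i < b) G i.
Proof.
move=> H; rewrite !big_nat.
elim/big_ind2: _ => [|x1 x2 y1 y2|//]; lra.
Qed.

Lemma sum_ge0 (a b : nat) (F : nat -> R) :
  (forall i, (a <= i < b)%N -> 0 <= F i) -> 0 <= \sum_(a <= i < b) F i.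
Proof.
move=> H; rewrite big_nat.
by elim/big_rec: _ => [|i x Hi Hx]; [lra | have := H i Hi; lra].
Qed.

Lemma sum_abs (a b : nat) (F : nat -> R) :
  Rabs (\sum_(a <= i < b) F i) <= \sum_(a <= i < b) Rabs (F i).
Proof.
elim/big_ind2: _ => [|x1 x2 y1 y2 H1 H2|i _]; [rewrite Rabs_R0; lra | | lra].
by apply: Rle_trans (Rabs_triang _ _) _; lra.
Qed.

Lemma sum_abs_le (a b : nat) (F G : nat -> R) :
  (forall i, (a <= i < b)%N -> Rabs (F i) <= G i) ->
  Rabs (\sum_(a <= i < b) F i) <= \sum_(a <= i < b) G i.
Proof. by move=> H; apply: Rle_trans (sum_abs _ _ _) (sum_le _). Qed.

Lemma sum_cat (a b c : nat) (F : nat -> R) : (a <= b <= c)%N ->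
  \sum_(a <= i < c) F i = \sum_(a <= i < b) F i + \sum_(b <= i < c) F i.
Proof. by case/andP=> ab bc; rewrite (big_cat_nat ab bc). Qed.

Lemma sum_multiples (T : Type) (idx : T) (op : Monoid.com_law idx)
    (G : nat -> T) (d N : nat) : (0 < d)%N ->
  \big[op/idx]_(1 <= n < N.+1 | (d %| n)%N) G n =
  \big[op/idx]_(1 <= m < (N %/ d).+1) G (d * m)%N.
Proof.
move=> d0; elim: N => [|N IH]; first by rewrite div0n !big_geq.
rewrite big_mkcond big_nat_recr //= -big_mkcond /= IH divnS //.
case: (boolP (d %| N.+1)%N) => dN; last by rewrite add0n Monoid.mulm1.
rewrite add1n [RHS]big_nat_recr //=; congr (op _ (G _)).
by have := divnS N d0; rewrite dN add1n => <-; rewrite mulnC divnK.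
Qed.

Lemma dvdn_range (d n N : nat) : (0 < n <= N)%N -> (d %| n)%N -> (0 < d < N.+1)%N.
Proof. by move=> H dn; have := dvdn_leq _ dn; have := dvdn_gt0 _ dn; lia. Qed.

Lemma sum_divisors_widen (T : Type) (idx : T) (op : Monoid.com_law idx)
    (P : pred nat) (F : nat -> T) (n N : nat) : (0 < n <= N)%N ->
  \big[op/idx]_(1 <= d < n.+1 | (d %| n)%N && P d) F d =
  \big[op/idx]_(1 <= d < N.+1 | (d %| n)%N && P d) F d.
Proof.
move=> H; rewrite [RHS](big_cat_nat (n := n.+1)) //=; last by lia.
rewrite [X in op _ X]big1_seq ?Monoid.mulm1 // => d.
rewrite mem_index_iota => /andP[/andP[dn _]] Hd.
by have := @dvdn_range d n n; rewrite dn; lia.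
Qed.

(** Both sides run over the pairs with [d * m <= N]. The commutative monoid is arbitrary so that
    real and complex sums share the lemma. *)
Lemma sum_hyperbola (T : Type) (idx : T) (op : Monoid.com_law idx)
    (F : nat -> nat -> T) (N : nat) :
  \big[op/idx]_(1 <= n < N.+1)
     \big[op/idx]_(1 <= d < n.+1 | (d %| n)%N) F d (n %/ d)%N =
  \big[op/idx]_(1 <= d < N.+1) \big[op/idx]_(1 <= m < (N %/ d).+1) F d m.
Proof.
transitivity (\big[op/idx]_(1 <= n < N.+1)
     \big[op/idx]_(1 <= d < N.+1 | (d %| n)%N) F d (n %/ d)%N).
  apply: eq_big_nat => n Hn.
  have := @sum_divisors_widen T idx op xpredT (fun d => F d (n %/ d)%N) n N.
  by under eq_bigl do rewrite andbT; under [in RHS]eq_bigl do rewrite andbT; apply; lia.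
rewrite (exchange_big_dep xpredT) //=; apply: eq_big_nat => d Hd.
rewrite sum_multiples; last by lia.
by apply: eq_big_nat => m Hm; rewrite mulKn //; lia.
Qed.

(** * Dirichlet convolution *)

Definition conv (f g : nat -> R) (n : nat) : R :=
  \sum_(1 <= d < n.+1 | d %| n) (f d * g (n %/ d)%N).

Lemma sum_conv (f g h : nat -> R) (N : nat) :
  \sum_(1 <= n < N.+1) (conv f g n * h n) =
  \sum_(1 <= d < N.+1) (f d * \sum_(1 <= m < (N %/ d).+1) (g m * h (d * m)%N)).
Proof.
under [RHS]eq_bigr do rewrite -sum_distrl.
rewrite -(sum_hyperbola Rplus (fun d m => f d * (g m * h (d * m)%N))).
apply: eq_big_nat => n Hn; rewrite Rmult_comm -sum_distrl.
by apply: eq_bigr => d dn; rewrite mulnC divnK //; lra.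
Qed.

Lemma sum_conv1 (f g : nat -> R) (N : nat) :
  \sum_(1 <= n < N.+1) conv f g n =
  \sum_(1 <= d < N.+1) (f d * \sum_(1 <= m < (N %/ d).+1) g m).
Proof.
have := sum_conv f g (fun=> 1) N.
under eq_bigr do rewrite Rmult_1_r.
by move=> ->; apply: eq_bigr => d _; under eq_bigr do rewrite Rmult_1_r.
Qed.

(** Allows identities of arithmetic functions to be proved on summatory functions, where [sum_conv1]
    makes a convolution a double sum; [convC] and [convA] are obtained in this way. *)
Lemma sums_inj (f g : nat -> R) :
  (forall N, \sum_(1 <= n < N.+1) f n = \sum_(1 <= n < N.+1) g n) ->
  forall n, (0 < n)%N -> f n = g n.
Proof.
move=> H [//|n] _; have := H n.+1; rewrite !sum_recr H; lra.
Qed.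

Lemma conv_ext (f f' g g' : nat -> R) (n : nat) :
  (forall k, (0 < k)%N -> f k = f' k) -> (forall k, (0 < k)%N -> g k = g' k) ->
  conv f g n = conv f' g' n.
Proof.
move=> Hf Hg; rewrite /conv big_nat_cond [RHS]big_nat_cond.
apply: eq_bigr => d /andP[Hd dn]; rewrite Hf ?Hg //; last by lia.
by rewrite divn_gt0; lia.
Qed.

Lemma convC (f g : nat -> R) (n : nat) : (0 < n)%N -> conv f g n = conv g f n.
Proof.
move: n; apply: sums_inj => N; rewrite !sum_conv1.
transitivity (\sum_(1 <= d < N.+1) \sum_(1 <= m < N.+1 | (d * m <= N)%N) (f d * g m)).
  apply: eq_big_nat => d Hd; rewrite -sum_distrl.
  rewrite [LHS](big_nat_widen _ _ N.+1); last by rewrite ltnS leq_div.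
  rewrite [LHS]big_nat_cond [RHS]big_nat_cond; apply: eq_bigl => m.
  by rewrite !ltnS leq_divRL ?[(m * d)%N]mulnC //; lia.
rewrite (exchange_big_dep xpredT) //=.
apply: eq_big_nat => d Hd; rewrite -sum_distrl.
rewrite [RHS](big_nat_widen _ _ N.+1); last by rewrite ltnS leq_div.
rewrite [LHS]big_nat_cond [RHS]big_nat_cond; apply: eq_big => [m|m _]; last by lra.
by rewrite !ltnS leq_divRL; lia.
Qed.

(** On summatory functions this comes down to [N %/ (d * m) = N %/ d %/ m]. *)
Lemma convA (f g h : nat -> R) (n : nat) : (0 < n)%N ->
  conv f (conv g h) n = conv (conv f g) h n.
Proof.
move: n; apply: sums_inj => N; rewrite !sum_conv1 sum_conv.
apply: eq_bigr => d _; rewrite sum_conv1; congr (_ * _).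
by apply: eq_bigr => m _; rewrite divnMA.
Qed.

Lemma conv_addr (f g h : nat -> R) (n : nat) :
  conv f (fun k => g k + h k) n = conv f g n + conv f h n.
Proof. by rewrite -sum_add; apply: eq_bigr => d _; lra. Qed.

Lemma conv_oppl (f g : nat -> R) (n : nat) :
  conv (fun k => - f k) g n = - conv f g n.
Proof. by rewrite -sum_opp; apply: eq_bigr => d _; lra. Qed.

Lemma conv_oppr (f g : nat -> R) (n : nat) :
  conv f (fun k => - g k) n = - conv f g n.
Proof. by rewrite -sum_opp; apply: eq_bigr => d _; lra. Qed.

Lemma conv_ge0 (f g : nat -> R) (n : nat) :
  (forall k, (0 < k)%N -> 0 <= f k) -> (forall k, (0 < k)%N -> 0 <= g k) ->
  0 <= conv f g n.
Proof.
move=> Hf Hg; rewrite /conv big_mkcond; apply: sum_ge0 => d Hd.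
case: ifP => dn; last by lra.
by apply: Rmult_le_pos; [apply: Hf | apply: Hg; rewrite divn_gt0]; lia.
Qed.

Definition unit1 (n : nat) : R := if n == 1%N then 1 else 0.

Lemma conv1l (f : nat -> R) (n : nat) : (0 < n)%N -> conv unit1 f n = f n.
Proof.
move=> n0; rewrite /conv big_ltn_cond; last by lia.
rewrite dvd1n divn1 /unit1 /= Rmult_1_l big1_seq; first by lra.
move=> d; rewrite mem_index_iota => /andP[_ Hd].
by case: eqP => [|_]; [lia | lra].
Qed.

Definition lnmul (f : nat -> R) (n : nat) : R := f n * ln (INR n).

Lemma INR_pos (n : nat) : (0 < n)%N -> 0 < INR n.
Proof. by move=> H; apply: lt_0_INR; lia. Qed.

Lemma lnmul_conv (f g : nat -> R) (n : nat) : (0 < n)%N ->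
  lnmul (conv f g) n = conv (lnmul f) g n + conv f (lnmul g) n.
Proof.
move=> n0; rewrite /lnmul /conv -sum_add Rmult_comm -sum_distrl.
rewrite big_nat_cond [RHS]big_nat_cond; apply: eq_bigr => d /andP[Hd dn].
rewrite -{1}(divnK dn) mulnC mult_INR ln_mult; first by lra.
  by apply: INR_pos; lia.
by apply: INR_pos; rewrite divn_gt0; lia.
Qed.

(** * The Moebius and von Mangoldt functions *)

Definition mu (n : nat) : R :=
  if all (fun p => ~~ (p ^ 2 %| n)%N) (primes n) then (-1) ^ size (primes n) else 0.

Lemma mu1 : mu 1 = 1.
Proof. by rewrite /mu /=. Qed.

Lemma mu_bound (n : nat) : Rabs (mu n) <= 1.
Proof.
rewrite /mu; case: ifP => _; last by rewrite Rabs_R0; lra.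
by rewrite pow_1_abs; lra.
Qed.

Lemma mu_mul_dvd (p d : nat) : prime p -> (0 < d)%N -> (p %| d)%N ->
  mu (p * d)%N = 0.
Proof.
move=> pp d0 pd; have p0 := prime_gt0 pp; rewrite /mu ifN //; apply/allPn; exists p.
  by rewrite primesM // primes_prime // inE eqxx.
by rewrite negbK expnS expn1 dvdn_pmul2l.
Qed.

Lemma mu_mul_coprime (p d : nat) : prime p -> (0 < d)%N -> ~~ (p %| d)%N ->
  mu (p * d)%N = - mu d.
Proof.
move=> pp d0 pd; have p0 := prime_gt0 pp.
have Hp : perm_eq (primes (p * d)) (p :: primes d).
  apply: uniq_perm; rewrite ?primes_uniq //=.
    by rewrite primes_uniq mem_primes pp d0 /= andbT.
  by move=> q; rewrite primesM // primes_prime // !inE.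
rewrite /mu (perm_all _ Hp) (perm_size Hp) /=.
rewrite {1}expnS expn1 dvdn_pmul2l // pd /=.
rewrite (@eq_in_all _ _ (fun q => ~~ (q ^ 2 %| d)%N)); first by case: ifP => _; lra.
move=> q; rewrite mem_primes => /and3P[pq _ qd] /=; rewrite Gauss_dvdr //.
by rewrite coprimeXl // prime_coprime // dvdn_prime2 //; apply: contra pd => /eqP <-.
Qed.

(** A divisor that [p] divides either has [mu = 0] or is [p * d] with [d] prime to [p] and
    [mu (p * d) = - mu d]. The differences on the right vanish for constant [f] and equal [ln p] for
    [f d = ln (n / d)]. *)
Lemma sum_mu_pairing (f : nat -> R) (p n : nat) :
  prime p -> (0 < n)%N -> (p %| n)%N ->
  \sum_(1 <= d < n.+1 | d %| n) (mu d * f d) =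
  \sum_(1 <= d < n.+1 | (d %| n) && ~~ (p %| d)) (mu d * (f d - f (p * d)%N)).
Proof.
move=> pp n0 pn; rewrite (bigID (fun d => p %| d)%N) /= Rplus_comm.
under [RHS]eq_bigr do rewrite Rmult_minus_distr_l.
rewrite sum_sub; congr (_ + _).
transitivity (\sum_(1 <= d < n.+1 | p %| d)
                (if (d %| n)%N then mu d * f d else 0)).
  by rewrite -big_mkcondr; apply: eq_bigl => d; rewrite andbC.
rewrite sum_multiples ?prime_gt0 // -sum_opp.
rewrite (big_nat_widen _ _ n.+1) ?ltnS ?leq_div // big_mkcond [RHS]big_mkcond /=.
apply: eq_big_nat => d Hd; case: (boolP (p %| d)%N) => pd; rewrite ?andbF ?andbT.
  by rewrite mu_mul_dvd //; [case: ifP => // _; case: ifP; lra | lia].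
rewrite mu_mul_coprime //; last by lia.
rewrite Gauss_dvd ?pn /=; last by rewrite prime_coprime.
case: (boolP (d %| n)%N) => dn; last by case: ifP.
have -> : (d < (n %/ p).+1)%N; last by lra.
rewrite ltnS leq_divRL ?prime_gt0 // dvdn_leq // Gauss_dvd ?dn ?pn //.
by rewrite coprime_sym prime_coprime.
Qed.

Lemma sum_mu_divisors (n : nat) : (0 < n)%N ->
  \sum_(1 <= d < n.+1 | d %| n) mu d = unit1 n.
Proof.
move=> n0; rewrite /unit1; case: (n =P 1%N) => [->|n1].
  by rewrite big_ltn_cond //= big_geq // mu1; lra.
have pp : prime (pdiv n) by apply: pdiv_prime; lia.
have := sum_mu_pairing (fun=> 1) pp n0 (pdiv_dvd n).
under eq_bigr do rewrite Rmult_1_r.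
by move=> ->; rewrite big1 // => d _; lra.
Qed.

Lemma conv_mu1 (n : nat) : (0 < n)%N -> conv mu (fun=> 1) n = unit1 n.
Proof.
by move=> n0; rewrite -sum_mu_divisors //; apply: eq_bigr => d _; lra.
Qed.

Lemma conv_1mu (n : nat) : (0 < n)%N -> conv (fun=> 1) mu n = unit1 n.
Proof. by move=> n0; rewrite convC // conv_mu1. Qed.

Definition lnN (n : nat) : R := ln (INR n).

Lemma lnN_ge0 (n : nat) : (0 < n)%N -> 0 <= lnN n.
Proof.
move=> n0; rewrite /lnN -ln_1; case: (n =P 1%N) => [->|n1]; first by rewrite /=; lra.
by apply/Rlt_le/ln_increasing; [lra | rewrite -[1]/(INR 1); apply: lt_INR; lia].
Qed.

(** Moebius inversion of [1 * Lambda = ln] serves as the definition instead of the values on prime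
    powers: the sequel works with convolution identities and nonnegativity. *)
Definition vonM : nat -> R := conv mu lnN.

(* Pairing [d] with [p d] in [sum mu(d) ln(n/d)] leaves [ln p] times
   [sum mu(d)] over the divisors [d] of the prime-to-[p] part of [n]. *)
Lemma vonM_ge0 (n : nat) : (0 < n)%N -> 0 <= vonM n.
Proof.
move=> n0; case: (n =P 1%N) => [->|n1].
  rewrite /vonM /conv big_ltn_cond //= big_geq // divn1 /lnN /= ln_1; lra.
set p := pdiv n; have pp : prime p by apply: pdiv_prime; lia.
have pn : (p %| n)%N by apply: pdiv_dvd.
rewrite /vonM /conv (sum_mu_pairing (fun d => lnN (n %/ d)) pp n0 pn).
have [m cpm nE] := pfactor_coprime pp n0.
have m0 : (0 < m)%N by move: n0; rewrite nE muln_gt0 => /andP[].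
rewrite (eq_bigr (fun d => lnN p * mu d)); last first.
  move=> d /andP[dn pd]; rewrite Rmult_comm; congr (_ * _).
  have pdn : (p * d %| n)%N by rewrite Gauss_dvd ?pn ?dn // prime_coprime.
  have pd0 : (0 < p * d)%N by apply: dvdn_gt0 pdn.
  have -> : (n %/ d = p * (n %/ (p * d)))%N.
    have d0 : (0 < d)%N by lia.
    by apply/eqP; rewrite eq_sym eqn_div // mulnAC mulnC divnK.
  rewrite /lnN mult_INR ln_mult; first by lra.
    by apply: INR_pos; apply: prime_gt0.
  by apply: INR_pos; rewrite divn_gt0 // dvdn_leq.
rewrite sum_distrl; apply: Rmult_le_pos; first exact/lnN_ge0/prime_gt0.
suff -> : \sum_(1 <= d < n.+1 | (d %| n) && ~~ (p %| d)) mu d = unit1 m.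
  by rewrite /unit1; case: ifP; lra.
rewrite -sum_mu_divisors //.
have := @sum_divisors_widen R 0 Rplus xpredT mu m n.
under eq_bigl do rewrite andbT; under [in RHS]eq_bigl do rewrite andbT.
move=> ->; last by rewrite m0 nE leq_pmulr // expn_gt0 prime_gt0.
apply: eq_bigl => d; apply/andP/idP => [[dn pd]|dm].
  by move: dn; rewrite nE Gauss_dvdl // coprimeXr // coprime_sym prime_coprime.
split; first by rewrite nE dvdn_mulr.
by rewrite -prime_coprime //; apply: coprime_dvdr dm cpm.
Qed.

Lemma conv_1vonM (n : nat) : (0 < n)%N -> conv (fun=> 1) vonM n = lnN n.
Proof.
move=> n0; rewrite convA // -[RHS]conv1l //; apply: conv_ext => // k k0.
exact: conv_1mu.
Qed.

(* Logarithmic differentiation [lnmul] is a derivation for [conv]; it is applied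
   to [mu * 1 = unit1]. *)
Lemma lnmul_mu (n : nat) : (0 < n)%N -> lnmul mu n = - conv mu vonM n.
Proof.
move=> n0.
have H k : (0 < k)%N -> conv (lnmul mu) (fun=> 1) k = - vonM k.
  move=> k0; have := lnmul_conv mu (fun=> 1) k0.
  have -> : lnmul (conv mu (fun=> 1)) k = 0.
    rewrite /lnmul conv_mu1 // /unit1; case: eqP => [->|_]; last by lra.
    by rewrite /= ln_1; lra.
  have -> : conv mu (lnmul (fun=> 1)) k = vonM k; last by lra.
  by apply: conv_ext => // j _; rewrite /lnmul /lnN; lra.
have E1 : conv (conv (lnmul mu) (fun=> 1)) mu n = lnmul mu n.
  rewrite -convA // convC // -[RHS]conv1l //.
  by apply: conv_ext => // k k0; rewrite conv_1mu.
rewrite -E1 -conv_oppr convC //.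
by apply: conv_ext => // k k0; rewrite H.
Qed.

(** Selberg's function, which [conv_mu_ln2] identifies with [mu * ln^2]. *)
Definition vonM2 (n : nat) : R := conv vonM vonM n + lnmul vonM n.

(** The derivation applied to [1 * Lambda = ln] gives [ln^2 = 1 * vonM2]; convolution with [mu] then
    cancels the [1]. *)
Lemma conv_mu_ln2 (n : nat) : (0 < n)%N ->
  conv mu (lnmul lnN) n = vonM2 n.
Proof.
move=> n0.
have H k : (0 < k)%N -> lnmul lnN k = conv (fun=> 1) vonM2 k.
  move=> k0; rewrite conv_addr convA //.
  rewrite (@conv_ext (conv (fun=> 1) vonM) lnN vonM vonM) //; last exact: conv_1vonM.
  have := lnmul_conv (fun=> 1) vonM k0; rewrite {1}/lnmul conv_1vonM //.
  rewrite -[lnN k * _]/(lnmul lnN k) => ->; congr (_ + _).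
  by apply: conv_ext => // j _; rewrite /lnmul /lnN; lra.
rewrite (@conv_ext mu mu (lnmul lnN) (conv (fun=> 1) vonM2)) // convA //.
by rewrite -[RHS]conv1l //; apply: conv_ext => // k k0; rewrite conv_mu1.
Qed.

(** Differentiates [mu ln = - mu * Lambda] once more; the new factor [mu ln] is again replaced by
    [- mu * Lambda], which fixes the sign of [Lambda * Lambda]. *)
Lemma lnmul2_mu (n : nat) : (0 < n)%N ->
  lnmul (lnmul mu) n = conv mu (fun k => conv vonM vonM k - lnmul vonM k) n.
Proof.
move=> n0; rewrite conv_addr convA // conv_oppr.
have -> : lnmul (lnmul mu) n = - lnmul (conv mu vonM) n.
  by rewrite /lnmul -/(lnmul mu n) lnmul_mu //; lra.
rewrite lnmul_conv // (@conv_ext _ (fun k => - conv mu vonM k) vonM vonM) //.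
  by rewrite conv_oppl; lra.
by move=> k k0; rewrite lnmul_mu.
Qed.

(** Two nonnegative terms differ by at most their sum, and the summatory function of that sum is
    known from Selberg's formula. *)
Lemma vonM_diff_le (n : nat) : (0 < n)%N ->
  Rabs (conv vonM vonM n - lnmul vonM n) <= vonM2 n.
Proof.
move=> n0; have H1 : 0 <= conv vonM vonM n by apply: conv_ge0; exact: vonM_ge0.
have H2 : 0 <= lnmul vonM n.
  by apply: Rmult_le_pos; [exact: vonM_ge0 | exact: lnN_ge0].
by apply: Rabs_le; rewrite /vonM2; lra.
Qed.

(** * Elementary estimates *)

Lemma ln_le_sub1 (x : R) : 0 < x -> ln x <= x - 1.
Proof. by move=> x0; have := exp_ineq1_le (ln x); rewrite exp_ln //; lra. Qed.

Lemma Rabs_le_inv (x a : R) : Rabs x <= a -> - a <= x <= a.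
Proof. by move=> H; have := Rle_abs x; have := Rle_abs (- x); rewrite Rabs_Ropp; lra. Qed.

Lemma ln_le_mono (x y : R) : 0 < x -> x <= y -> ln x <= ln y.
Proof. by move=> x0 [xy|->]; [apply/Rlt_le/ln_increasing | lra]. Qed.

Lemma sqrt_INR_pos (n : nat) : (0 < n)%N -> 0 < sqrt (INR n).
Proof. by move=> n0; apply/sqrt_lt_R0/INR_pos. Qed.

Lemma sqr_sqrt_INR (n : nat) : sqrt (INR n) * sqrt (INR n) = INR n.
Proof. by apply/sqrt_sqrt/pos_INR. Qed.

Lemma INR_ge1 (n : nat) : (0 < n)%N -> 1 <= INR n.
Proof. by move=> H; rewrite -[1]/(INR 1); apply: le_INR; lia. Qed.

Lemma sqrt_INR_ge1 (n : nat) : (0 < n)%N -> 1 <= sqrt (INR n).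
Proof. by move=> H; rewrite -sqrt_1; apply/sqrt_le_1_alt/INR_ge1. Qed.

Lemma lnN_le_sqrt (n : nat) : (0 < n)%N -> lnN n <= 2 * sqrt (INR n) - 2.
Proof.
move=> n0; rewrite /lnN -{1}(sqr_sqrt_INR n).
have H := sqrt_INR_pos n0; rewrite ln_mult //.
by have := ln_le_sub1 H; lra.
Qed.

Lemma lnN_step (k : nat) : (0 < k)%N ->
  / INR k.+1 <= lnN k.+1 - lnN k <= / INR k.
Proof.
move=> k0; have H := INR_pos k0; rewrite /lnN S_INR.
split.
  have /ln_le_sub1 : 0 < INR k / (INR k + 1) by apply: Rdiv_lt_0_compat; lra.
  rewrite /Rdiv ln_mult ?ln_Rinv //; try (apply: Rinv_0_lt_compat); try lra.
  suff -> : INR k * / (INR k + 1) - 1 = - / (INR k + 1) by lra.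
  by field; lra.
have /ln_le_sub1 : 0 < (INR k + 1) / INR k by apply: Rdiv_lt_0_compat; lra.
rewrite /Rdiv ln_mult ?ln_Rinv //; try (apply: Rinv_0_lt_compat); try lra.
suff -> : (INR k + 1) * / INR k - 1 = / INR k by lra.
by field; lra.
Qed.

Lemma sqrt_step (k : nat) :
  / sqrt (INR k.+1) <= 2 * (sqrt (INR k.+1) - sqrt (INR k)).
Proof.
have Hb : 0 < sqrt (INR k.+1) by apply: sqrt_INR_pos.
have Ha := sqrt_pos (INR k).
have Ea := sqr_sqrt_INR k; have := sqr_sqrt_INR k.+1; rewrite {3}S_INR => Eb.
move: (sqrt (INR k.+1)) (sqrt (INR k)) Hb Ha Eb Ea => b a Hb Ha Eb Ea.
apply: (Rmult_le_reg_l b) => //; rewrite Rinv_r; last by lra.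
nra.
Qed.

Lemma sum_inv_sqrt (N : nat) :
  \sum_(1 <= d < N.+1) / sqrt (INR d) <= 2 * sqrt (INR N).
Proof.
elim: N => [|N IH]; first by rewrite big_geq //= sqrt_0; lra.
by rewrite sum_recr; have := sqrt_step N; lra.
Qed.

Lemma INR_divn_le (N d : nat) : (0 < d)%N -> INR (N %/ d) <= INR N / INR d.
Proof.
move=> d0; have H := INR_pos d0; apply: (Rmult_le_reg_r (INR d)) => //.
rewrite /Rdiv Rmult_assoc Rinv_l; last by lra.
by rewrite Rmult_1_r -mult_INR; apply: le_INR; have := leq_divM N d; lia.
Qed.

Lemma INR_divn_gt (N d : nat) : (0 < d)%N -> INR N / INR d < INR (N %/ d) + 1.
Proof.
move=> d0; have H := INR_pos d0; apply: (Rmult_lt_reg_r (INR d)) => //.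
rewrite /Rdiv Rmult_assoc Rinv_l; last by lra.
rewrite Rmult_1_r -S_INR -mult_INR; apply: lt_INR.
by have := ltn_ceil N d0; lia.
Qed.

Lemma sum_mu_sqrt (F : nat -> R) (A : R) (N : nat) : 0 <= A ->
  (forall d, (0 < d <= N)%N -> Rabs (F d) <= A * sqrt (INR (N %/ d))) ->
  Rabs (\sum_(1 <= d < N.+1) (mu d * F d)) <= 2 * A * INR N.
Proof.
move=> A0 HF.
apply: (@Rle_trans _ (\sum_(1 <= d < N.+1) (A * sqrt (INR N) * / sqrt (INR d)))).
  apply: sum_abs_le => d Hd; rewrite Rabs_mult.
  have := HF d; have := mu_bound d; have := Rabs_pos (mu d); have := Rabs_pos (F d).
  move=> H1 H2 H3 /(_ ltac:(lia)) H4.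
  apply: (@Rle_trans _ (1 * (A * sqrt (INR (N %/ d))))); first by apply: Rmult_le_compat.
  rewrite Rmult_1_l Rmult_assoc; apply: Rmult_le_compat_l => //.
  rewrite -sqrt_inv -sqrt_mult_alt; last exact: pos_INR.
  by apply/sqrt_le_1_alt/INR_divn_le; lia.
rewrite sum_distrl; have := sum_inv_sqrt N; have := sqr_sqrt_INR N.
have := sqrt_pos (INR N); move: (\sum_(1 <= d < N.+1) _) (sqrt (INR N)) => S r r0 <- HS.
have : A * r * S <= A * r * (2 * r) by apply: Rmult_le_compat_l; [apply: Rmult_le_pos | ].
lra.
Qed.

(** Increments dominated by the decrements of [r] make [E] Cauchy, with tail at most [r k]. This
    supplies Stirling-type constants, and later the value of zeta, without naming them. *)
Lemma cv_of_telescope (E r : nat -> R) : Un_cv r 0 ->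
  (forall k, (0 < k)%N -> 0 <= r k) ->
  (forall k, (0 < k)%N -> Rabs (E k.+1 - E k) <= r k - r k.+1) ->
  exists c, Un_cv E c /\ forall k, (0 < k)%N -> Rabs (E k - c) <= r k.
Proof.
move=> rcv r0 HE.
have Hd k j : (0 < k)%N -> Rabs (E (k + j)%N - E k) <= r k - r (k + j)%N.
  move=> k0; elim: j => [|j IH]; first by rewrite addn0 Rminus_diag Rabs_R0; lra.
  rewrite addnS; have := HE (k + j)%N ltac:(lia).
  have -> : E (k + j).+1 - E k = (E (k + j).+1 - E (k + j)%N) + (E (k + j)%N - E k) by lra.
  by move=> H; apply: Rle_trans (Rabs_triang _ _) _; lra.
have Hb k j : (0 < k)%N -> Rabs (E (k + j)%N - E k) <= r k.
  by move=> k0; have := Hd k j k0; have := r0 (k + j)%N ltac:(lia); lra.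
have Cau : Cauchy_crit E.
  move=> e e0; have [N0 HN0] := rcv (e / 2) ltac:(lra); exists N0.+1 => n m Hn Hm.
  have := HN0 N0.+1 ltac:(lia); rewrite /Rdist Rminus_0_r => /Rabs_def2 [H1 H2].
  have := Hb N0.+1 (n - N0.+1)%N isT; have := Hb N0.+1 (m - N0.+1)%N isT.
  have -> : (N0.+1 + (m - N0.+1) = m)%N by lia.
  have -> : (N0.+1 + (n - N0.+1) = n)%N by lia.
  move=> /Rabs_le_inv [? ?] /Rabs_le_inv [? ?]; rewrite /Rdist.
  by apply: Rabs_def1; lra.
have [c Hc] := R_complete E Cau; exists c; split=> // k k0.
apply: Rnot_lt_le => Hlt.
have [N0 HN0] := Hc (Rabs (E k - c) - r k) ltac:(lra).
have := HN0 (k + N0)%N ltac:(lia); have := Hb k N0 k0; rewrite /Rdist => H1 H2.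
have := Rabs_triang (E k - E (k + N0)%N) (E (k + N0)%N - c).
have -> : E k - E (k + N0)%N + (E (k + N0)%N - c) = E k - c by lra.
by rewrite (Rabs_minus_sym (E k) (E (k + N0)%N)); lra.
Qed.

Lemma cv_inv_sqrt (A : R) : 0 <= A -> Un_cv (fun k => A * / sqrt (INR k)) 0.
Proof.
move=> A0 e e0; have [N0 HN0] := INR_unbounded (A * A / (e * e)).
exists N0.+1 => n Hn; rewrite /Rdist Rminus_0_r.
have n0 : (0 < n)%N by lia.
have Hs := sqrt_INR_pos n0.
rewrite Rabs_pos_eq; last by apply: Rmult_le_pos => //; apply/Rlt_le/Rinv_0_lt_compat.
apply: (Rmult_lt_reg_r (sqrt (INR n))) => //; rewrite Rmult_assoc Rinv_l; last by lra.
rewrite Rmult_1_r.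
have Hn1 : INR N0 <= INR n by apply: le_INR; lia.
have : A * A < INR n * (e * e).
  have -> : A * A = A * A / (e * e) * (e * e) by field; lra.
  by apply: Rmult_lt_compat_r; nra.
rewrite -{1}(sqr_sqrt_INR n) => H.
have He : 0 < e by lra.
by apply: Rsqr_incrst_0; rewrite /Rsqr //; first nra; apply: Rmult_le_pos; lra.
Qed.

(** Makes [2 * A / sqrt k] an admissible [r] in [cv_of_telescope] for increments bounded by
    [A / (sqrt k * (k + 1))]. *)
Lemma inv_sqrt_step (k : nat) : (0 < k)%N ->
  / sqrt (INR k) * / INR k.+1 <= 2 * (/ sqrt (INR k) - / sqrt (INR k.+1)).
Proof.
move=> k0; have Ha := sqrt_INR_pos k0; have Hb : 0 < sqrt (INR k.+1) by apply: sqrt_INR_pos.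
have H := sqrt_step k.
rewrite -{1}(sqr_sqrt_INR k.+1) Rinv_mult.
have -> : / sqrt (INR k) - / sqrt (INR k.+1) =
          / sqrt (INR k) * / sqrt (INR k.+1) * (sqrt (INR k.+1) - sqrt (INR k)).
  by field; lra.
have P : 0 < / sqrt (INR k) * / sqrt (INR k.+1).
  by apply: Rmult_lt_0_compat; apply: Rinv_0_lt_compat.
move: P H; set u := / sqrt (INR k); set v := / sqrt (INR k.+1).
nra.
Qed.

(** * Chebyshev, Mertens and Selberg *)

Lemma sum_1 (N : nat) : \sum_(1 <= m < N.+1) 1 = INR N.
Proof. by elim: N => [|N IH]; [rewrite big_geq | rewrite sum_recr IH S_INR]. Qed.

Lemma sum_unit1 (f : nat -> R) (N : nat) : (0 < N)%N ->
  \sum_(1 <= n < N.+1) (unit1 n * f n) = f 1%N.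
Proof.
move=> N0; rewrite big_ltn // big1_seq; first by rewrite /unit1 /=; lra.
by move=> n; rewrite mem_index_iota /unit1 => Hn; case: eqP => [|_]; [lia | lra].
Qed.

Lemma sum_mu_floor (N : nat) : (0 < N)%N ->
  \sum_(1 <= d < N.+1) (mu d * INR (N %/ d)) = 1.
Proof.
move=> N0; rewrite -(sum_unit1 (fun=> 1) N0).
under eq_bigr do rewrite -sum_1.
by rewrite -sum_conv1; apply: eq_big_nat => n Hn; rewrite conv_mu1; [lra | lia].
Qed.

(* If [F k = sum_(m <= k) f m] is [k * sum_(m <= k) a m / m + c k + O(sqrt k)],
   then Moebius inversion transfers [a] to [f], because [sum mu(d) (N/d)] over
   integer parts equals 1 and [sum_(d <= N) sqrt (N/d) = O(N)]. *)
Lemma mobius_transfer (f a : nat -> R) (A : R) : 0 <= A ->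
  (forall k, (0 < k)%N ->
     Rabs (f k.+1 - (\sum_(1 <= m < k.+1) f m) / INR k - a k.+1) <= A / sqrt (INR k)) ->
  (forall m, (0 < m)%N -> Rabs (a m) <= A * sqrt (INR m)) ->
  exists C, 0 <= C /\ forall N,
    Rabs (\sum_(1 <= n < N.+1) conv mu f n
          - INR N * \sum_(1 <= n < N.+1) (conv mu a n * / INR n)) <= C * INR N.
Proof.
move=> A0 Hf Ha.
pose F k := \sum_(1 <= m < k.+1) f m.
pose K k := \sum_(1 <= m < k.+1) (a m * / INR m).
pose E k := F k / INR k - K k.
have [||c [_ Hc]] := @cv_of_telescope E (fun k => 2 * A * / sqrt (INR k))
  (@cv_inv_sqrt (2 * A) ltac:(lra)).
- move=> k k0; apply: Rmult_le_pos; first by lra.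
  exact/Rlt_le/Rinv_0_lt_compat/sqrt_INR_pos.
- move=> k k0; have H1 := INR_pos k0; have H2 : 0 < INR k.+1 by apply: INR_pos.
  (* The first hypothesis bounds exactly [(k + 1)] times the increment of [E], which explains its
     shape. *)
  have -> : E k.+1 - E k = (f k.+1 - F k / INR k - a k.+1) * / INR k.+1.
    rewrite /E /F /K !sum_recr; rewrite S_INR in H2 *; field; lra.
  rewrite Rabs_mult (Rabs_pos_eq (/ _)); last exact/Rlt_le/Rinv_0_lt_compat.
  apply: (@Rle_trans _ (A / sqrt (INR k) * / INR k.+1)).
    by apply: Rmult_le_compat_r (Hf k k0); exact/Rlt_le/Rinv_0_lt_compat.
  by have := inv_sqrt_step k0; rewrite /Rdiv; nra.
have HK k : Rabs (K k) <= 2 * A * sqrt (INR k).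
  apply: (@Rle_trans _ (\sum_(1 <= m < k.+1) (A * / sqrt (INR m)))).
    apply: sum_abs_le => m Hm; have m0 : (0 < m)%N by lia.
    have H1 := sqrt_INR_pos m0; have H2 := INR_pos m0.
    rewrite Rabs_mult (Rabs_pos_eq (/ _)); last exact/Rlt_le/Rinv_0_lt_compat.
    apply: (@Rle_trans _ (A * sqrt (INR m) * / INR m)).
      by apply: Rmult_le_compat_r (Ha m m0); exact/Rlt_le/Rinv_0_lt_compat.
    by rewrite -{2}(sqr_sqrt_INR m); apply: Req_le; field; lra.
  by rewrite sum_distrl; have := sum_inv_sqrt k; nra.
have HF k : (0 < k)%N -> Rabs (F k - INR k * K k - c * INR k) <= 2 * A * sqrt (INR k).
  move=> k0; have H1 := sqrt_INR_pos k0; have H2 := INR_pos k0.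
  have -> : F k - INR k * K k - c * INR k = INR k * (E k - c) by rewrite /E; field; lra.
  rewrite Rabs_mult Rabs_pos_eq; last by lra.
  apply: (@Rle_trans _ (INR k * (2 * A * / sqrt (INR k)))).
    by apply: Rmult_le_compat_l (Hc k k0); lra.
  by rewrite -{1}(sqr_sqrt_INR k); apply: Req_le; field; lra.
exists (8 * A + Rabs c); split; first by have := Rabs_pos c; lra.
case=> [|N]; first by rewrite !big_geq //= Rmult_0_l Rminus_0_r Rabs_R0; lra.
move: (N.+1) (ltn0Sn N) => {N} N N0.
rewrite sum_conv1 sum_conv.
have -> : INR N * \sum_(1 <= d < N.+1)
     (mu d * \sum_(1 <= m < (N %/ d).+1) (a m * / INR (d * m))) =
   \sum_(1 <= d < N.+1) (mu d * (INR N / INR d * K (N %/ d)%N)).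
  rewrite -sum_distrl; apply: eq_big_nat => d Hd.
  rewrite /K -sum_distrl -!sum_distrl /Rdiv; apply: eq_big_nat => m Hm.
  have H1 : 0 < INR d by apply: INR_pos; lia.
  have H2 : 0 < INR m by apply: INR_pos; lia.
  by rewrite mult_INR; field; lra.
pose G d := F (N %/ d)%N - INR N / INR d * K (N %/ d)%N - c * INR (N %/ d).
have -> : \sum_(1 <= d < N.+1) (mu d * \sum_(1 <= m < (N %/ d).+1) f m) -
          \sum_(1 <= d < N.+1) (mu d * (INR N / INR d * K (N %/ d)%N)) =
          \sum_(1 <= d < N.+1) (mu d * G d) + c.
  rewrite -[X in _ = _ + X]Rmult_1_r -(sum_mu_floor N0) -sum_distrl -sum_add -sum_sub.
  by apply: eq_bigr => d _; rewrite /G /F; ring.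
(* Of [4 * A], one half comes from [HF] and the other from the fractional part of [N / d] multiplied
   by the bound [HK]. *)
have HG : Rabs (\sum_(1 <= d < N.+1) (mu d * G d)) <= 2 * (4 * A) * INR N.
  apply: sum_mu_sqrt; first by lra.
  move=> d Hd; have d0 : (0 < d)%N by lia.
  have k0 : (0 < N %/ d)%N by rewrite divn_gt0; lia.
  have -> : G d = F (N %/ d)%N - INR (N %/ d) * K (N %/ d)%N - c * INR (N %/ d)
              - (INR N / INR d - INR (N %/ d)) * K (N %/ d)%N by rewrite /G; ring.
  apply: Rle_trans (Rabs_triang _ _) _; rewrite Rabs_Ropp Rabs_mult.
  have := HF _ k0; have := HK (N %/ d)%N.
  have := INR_divn_le N d0; have := INR_divn_gt N d0 => H1 H2.
  rewrite (Rabs_pos_eq (INR N / INR d - _)); last by lra.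
  by have := Rabs_pos (K (N %/ d)%N); nra.
apply: Rle_trans (Rabs_triang _ _) _.
by have := INR_ge1 N0; have := Rabs_pos c; nra.
Qed.

Lemma mul_ge1 (x y : R) : 0 < x -> / x <= y -> 1 <= x * y.
Proof. by move=> x0 H; have : x * / x = 1; [apply: Rinv_r; lra | nra]. Qed.

Lemma mul_le1 (x y : R) : 0 < x -> y <= / x -> x * y <= 1.
Proof. by move=> x0 H; have : x * / x = 1; [apply: Rinv_r; lra | nra]. Qed.

Lemma sum_lnN (k : nat) : (0 < k)%N ->
  Rabs (\sum_(1 <= m < k.+1) lnN m - (INR k * lnN k - INR k)) <= 2 * sqrt (INR k).
Proof.
(* The induction carries a sharper logarithmic bound: passing from [k] to [k + 1] adds [1 - k * dl]
   with [dl = ln (k + 1) - ln k], which lies between 0 and [dl]. *)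
move=> k0; suff : 0 <= \sum_(1 <= m < k.+1) lnN m - (INR k * lnN k - INR k) <= 1 + lnN k.
  by have := lnN_le_sqrt k0 => H1 H2; apply: Rabs_le; lra.
elim: k k0 => // -[_ _|k IH _].
  by rewrite big_nat1 /lnN /= ln_1; lra.
rewrite sum_recr; have {IH} := IH isT; move: (k.+1) (ltn0Sn k) => {k} k k0.
have H := INR_pos k0.
have [] := lnN_step k0; rewrite S_INR => H1 H2.
have {}H1 : 1 <= (INR k + 1) * (lnN k.+1 - lnN k) by apply: mul_ge1; lra.
have {}H2 : INR k * (lnN k.+1 - lnN k) <= 1 by apply: mul_le1.
move=> H3; split; lra.
Qed.

Lemma sum_lnN2 (k : nat) : (0 < k)%N ->
  Rabs (\sum_(1 <= m < k.+1) lnmul lnN m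
        - (INR k * (lnN k * lnN k) - 2 * INR k * lnN k + 2 * INR k)) <= 16 * sqrt (INR k).
Proof.
elim: k => // -[_ _|k IH _].
  rewrite big_nat1 /lnmul /lnN /= ln_1 sqrt_1; apply: Rabs_le; lra.
rewrite sum_recr; have {IH} := IH isT; move: (k.+1) (ltn0Sn k) => {k} k k0.
set S := \sum_(1 <= m < k.+1) _ => IH.
have H := INR_pos k0.
have [H1 H2] := lnN_step k0.
have {}H2 : INR k * (lnN k.+1 - lnN k) <= 1 by apply: mul_le1.
have H1' : 1 <= INR k.+1 * (lnN k.+1 - lnN k) by apply: mul_ge1; first exact: INR_pos.
have H3 := @lnN_le_sqrt k.+1 isT; have H4 := lnN_ge0 k0.
have H5 := @lnN_ge0 k.+1 isT.
have H6 := sqrt_step k; have H7 := sqr_sqrt_INR k.+1.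
have H8 : 0 < sqrt (INR k.+1) by apply: sqrt_INR_pos.
rewrite /lnmul -/(lnN k.+1).
have Hk : INR k.+1 = INR k + 1 by rewrite S_INR.
have -> : S + lnN k.+1 * lnN k.+1 - (INR k.+1 * (lnN k.+1 * lnN k.+1)
            - 2 * INR k.+1 * lnN k.+1 + 2 * INR k.+1) =
   (S - (INR k * (lnN k * lnN k) - 2 * INR k * lnN k + 2 * INR k)) +
   (2 * (lnN k.+1 - 1) * (1 - INR k * (lnN k.+1 - lnN k))
    + INR k * (lnN k.+1 - lnN k) * (lnN k.+1 - lnN k)).
  by rewrite Hk; ring.
apply: Rle_trans (Rabs_triang _ _) _.
(* By [sqrt_step], an increment of at most [8 / sqrt (k + 1)] is absorbed by the growth of
   [16 * sqrt k]. *)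
suff : Rabs (2 * (lnN k.+1 - 1) * (1 - INR k * (lnN k.+1 - lnN k))
    + INR k * (lnN k.+1 - lnN k) * (lnN k.+1 - lnN k)) <= 8 * / sqrt (INR k.+1) by lra.
set b := sqrt (INR k.+1) in H3 H6 H7 H8 *.
set dl := lnN k.+1 - lnN k in H1 H1' H2 *.
have Hib : / INR k.+1 = / b * / b by rewrite -H7 Rinv_mult.
have Hb1 : b * / b = 1 by apply: Rinv_r; lra.
have Hib0 : 0 < / b by apply: Rinv_0_lt_compat.
have Hib1 : / b <= 1 by rewrite -Rinv_1; apply: Rinv_le_contravar; [lra | apply: sqrt_INR_ge1].
have Hd0 : 0 <= dl by rewrite Hib in H1; nra.
have Hd2 : dl <= 2 * (/ b * / b).
  have /(Rmult_le_compat_r dl) : INR k.+1 <= 2 * INR k by have := INR_ge1 k0; lra.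
  rewrite -H7 => /(_ Hd0) Hx.
  have -> : dl = b * b * dl * (/ b * / b) by field; lra.
  by apply: Rmult_le_compat_r; nra.
have P1 : 0 <= 1 - INR k * dl <= dl by rewrite Hk in H1'; lra.
have P2 : Rabs (lnN k.+1 - 1) <= 2 * b - 1 by apply: Rabs_le; nra.
apply: Rle_trans (Rabs_triang _ _) _.
rewrite !Rabs_mult (Rabs_pos_eq 2) ?(Rabs_pos_eq dl) ?(Rabs_pos_eq (INR k)) //; try lra.
rewrite (Rabs_pos_eq (1 - _)); last by lra.
have Q1 : 2 * Rabs (lnN k.+1 - 1) * (1 - INR k * dl) <=
          2 * (2 * b - 1) * (2 * (/ b * / b)).
  apply: Rmult_le_compat; try lra.
  by have := Rabs_pos (lnN k.+1 - 1); lra.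
have Q2 : INR k * dl * dl <= 1 * (2 * (/ b * / b)) by apply: Rmult_le_compat; nra.
have Q3 : 2 * (2 * b - 1) * (2 * (/ b * / b)) = 8 * / b - 4 * (/ b * / b).
  by field; lra.
nra.
Qed.

(** Transfer with [f = ln] and [a = 1]: here [mu * f] is [Lambda], while [mu * a = unit1]
    contributes only [N]. *)
Lemma chebyshev : exists C, 0 <= C /\ forall N, \sum_(1 <= n < N.+1) vonM n <= C * INR N.
Proof.
have [k k0|m m0|C [C0 HC]] := @mobius_transfer lnN (fun=> 1) 3 ltac:(lra).
- have H := sqrt_INR_pos k0; have H1 := INR_pos k0; have [_ H2] := lnN_step k0.
  have [H3 _] := lnN_step k0; have H4 : 0 < / INR k.+1.
    by apply/Rinv_0_lt_compat/INR_pos.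
  have -> : lnN k.+1 - (\sum_(1 <= m < k.+1) lnN m) / INR k - 1 =
    (lnN k.+1 - lnN k) -
    (\sum_(1 <= m < k.+1) lnN m - (INR k * lnN k - INR k)) / INR k by field; lra.
  apply: Rle_trans (Rabs_triang _ _) _; rewrite Rabs_Ropp Rabs_mult.
  rewrite (Rabs_pos_eq (/ _)); last exact/Rlt_le/Rinv_0_lt_compat.
  rewrite (Rabs_pos_eq (lnN k.+1 - lnN k)); last by lra.
  have := sum_lnN k0.
  move: (Rabs _) => X HX; have H5 := sqr_sqrt_INR k; have H6 := sqrt_INR_ge1 k0.
  have H7 : 0 < / sqrt (INR k) by apply: Rinv_0_lt_compat.
  have H8 : / INR k = / sqrt (INR k) * / sqrt (INR k) by rewrite -{1}H5 Rinv_mult.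
  have H9 : / INR k <= / sqrt (INR k).
    by apply: Rinv_le_contravar => //; rewrite -{2}H5; nra.
  have H10 : X * / INR k <= 2 * sqrt (INR k) * / INR k.
    by apply: Rmult_le_compat_r => //; lra.
  have H11 : 2 * sqrt (INR k) * / INR k = 2 * / sqrt (INR k).
    by rewrite H8; field; lra.
  by rewrite /Rdiv; lra.
- by rewrite Rabs_R1; have := sqrt_INR_ge1 m0; lra.
exists (C + 1); split; first by lra.
case=> [|N]; first by rewrite big_geq //= ; lra.
have := HC N.+1.
have -> : \sum_(1 <= n < N.+2) (conv mu (fun=> 1) n * / INR n) = 1.
  have H := @sum_unit1 (fun n => / INR n) N.+1 isT; rewrite /= Rinv_1 in H.
  rewrite -[RHS]H; apply: eq_big_nat => n Hn.
  by rewrite conv_mu1 //; lia.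
by move=> /Rabs_le_inv; rewrite -/vonM; lra.
Qed.

(** Summing [1 * Lambda = ln] expresses the sum of the logarithms as the sum of
    [Lambda(d) (N %/ d)]. Removing the integer parts costs at most the sum of [Lambda], which
    [chebyshev] bounds by [C * N]. *)
Lemma mertens : exists C, 0 <= C /\ forall N, (0 < N)%N ->
  Rabs (\sum_(1 <= n < N.+1) (vonM n * / INR n) - lnN N) <= C.
Proof.
have [C [C0 HC]] := chebyshev; exists (C + 3); split; first by lra.
move=> N N0; have HN := INR_pos N0.
have H1 : \sum_(1 <= m < N.+1) lnN m =
          \sum_(1 <= d < N.+1) (vonM d * INR (N %/ d)).
  under [RHS]eq_bigr do rewrite -sum_1.
  rewrite -sum_conv1; apply: eq_big_nat => n Hn.
  by rewrite convC ?conv_1vonM //; lia.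
have H2 : 0 <= INR N * \sum_(1 <= n < N.+1) (vonM n * / INR n) -
            \sum_(1 <= m < N.+1) lnN m <= C * INR N.
  rewrite H1 -sum_distrl -sum_sub; split.
    apply: sum_ge0 => d Hd; have d0 : (0 < d)%N by lia.
    have := INR_divn_le N d0; rewrite /Rdiv; have := vonM_ge0 d0; nra.
  apply: Rle_trans (HC N); apply: sum_le => d Hd; have d0 : (0 < d)%N by lia.
  have := INR_divn_gt N d0; rewrite /Rdiv; have := vonM_ge0 d0; nra.
have H3 := sum_lnN N0; have H4 := sqrt_INR_ge1 N0; have H5 := sqr_sqrt_INR N.
have {}H3 : Rabs (\sum_(1 <= m < N.+1) lnN m - (INR N * lnN N - INR N)) <= 2 * INR N by nra.
move/Rabs_le_inv: H3 => H3.
have -> : \sum_(1 <= n < N.+1) (vonM n * / INR n) - lnN N =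
  (INR N * \sum_(1 <= n < N.+1) (vonM n * / INR n) - INR N * lnN N) * / INR N.
  by field; lra.
rewrite Rabs_mult (Rabs_pos_eq (/ _)); last exact/Rlt_le/Rinv_0_lt_compat.
apply: (Rmult_le_reg_r (INR N)) => //; rewrite Rmult_assoc Rinv_l; last by lra.
by rewrite Rmult_1_r; apply: Rabs_le; nra.
Qed.

(** Transfer with [f = ln^2]. The choice [a = 2 ln - 2] is the gap between [ln^2 k] and its mean up
    to [k]; since [mu * a = 2 Lambda - 2 unit1], [mertens] evaluates the resulting sum. *)
Lemma selberg : exists C, 0 <= C /\ forall N, (0 < N)%N ->
  Rabs (\sum_(1 <= n < N.+1) vonM2 n - 2 * INR N * lnN N) <= C * INR N.
Proof.
have [k k0|m m0|C [C0 HC]] :=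
  @mobius_transfer (lnmul lnN) (fun n => 2 * lnN n - 2) 24 ltac:(lra).
- have H := sqrt_INR_pos k0; have H1 := INR_pos k0; have [H3 H2] := lnN_step k0.
  have H4 : 0 < / INR k.+1 by apply/Rinv_0_lt_compat/INR_pos.
  set S := \sum_(1 <= m < k.+1) lnmul lnN m.
  set T := S - (INR k * (lnN k * lnN k) - 2 * INR k * lnN k + 2 * INR k).
  have HT : Rabs T <= 16 * sqrt (INR k) by apply: sum_lnN2.
  have -> : lnmul lnN k.+1 - S / INR k - (2 * lnN k.+1 - 2) =
    (lnN k.+1 - lnN k) * (lnN k.+1 + lnN k - 2) - T * / INR k.
    by rewrite /T /lnmul -/(lnN k.+1); field; lra.
  apply: Rle_trans (Rabs_triang _ _) _; rewrite Rabs_Ropp !Rabs_mult.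
  rewrite (Rabs_pos_eq (/ _)); last by apply/Rlt_le/Rinv_0_lt_compat.
  rewrite (Rabs_pos_eq (lnN k.+1 - lnN k)); last by lra.
  have H5 := sqr_sqrt_INR k; have H6 := sqrt_INR_ge1 k0.
  have H7 : 0 < / sqrt (INR k) by apply: Rinv_0_lt_compat.
  have H8 : / INR k = / sqrt (INR k) * / sqrt (INR k) by rewrite -{1}H5 Rinv_mult.
  have H9 := lnN_le_sqrt k0; have H10 := lnN_ge0 k0.
  have H11 : / INR k <= 1.
    by rewrite -Rinv_1; apply: Rinv_le_contravar; [lra | apply: INR_ge1].
  have H12 : Rabs (lnN k.+1 + lnN k - 2) <= 4 * sqrt (INR k) by apply: Rabs_le; lra.
  have H13 : (lnN k.+1 - lnN k) * Rabs (lnN k.+1 + lnN k - 2) <= / INR k * (4 * sqrt (INR k)).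
    by apply: Rmult_le_compat; try lra; apply: Rabs_pos.
  have H14 : Rabs T * / INR k <= 16 * sqrt (INR k) * / INR k.
    by apply: Rmult_le_compat_r; [rewrite H8; nra | ].
  have H15 : sqrt (INR k) * / INR k = / sqrt (INR k) by rewrite H8; field; lra.
  by rewrite /Rdiv; nra.
- have := lnN_le_sqrt m0; have := lnN_ge0 m0; have := sqrt_INR_ge1 m0 => H1 H2 H3.
  by apply: Rabs_le; lra.
have [C' [C'0 HC']] := mertens.
exists (C + 2 * C' + 2); split; first by lra.
move=> N N0; have HN := INR_pos N0.
have := HC N; have -> : \sum_(1 <= n < N.+1) conv mu (lnmul lnN) n =
                       \sum_(1 <= n < N.+1) vonM2 n.
  by apply: eq_big_nat => n Hn; rewrite conv_mu_ln2 //; lia.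
have -> : \sum_(1 <= n < N.+1) (conv mu (fun k => 2 * lnN k - 2) n * / INR n) =
          2 * \sum_(1 <= n < N.+1) (vonM n * / INR n) - 2.
  have H := @sum_unit1 (fun n => 2 * / INR n) N N0; rewrite /= Rinv_1 Rmult_1_r in H.
  rewrite -[X in _ - X]H -sum_distrl -sum_sub; apply: eq_big_nat => n Hn.
  have -> : conv mu (fun k => 2 * lnN k - 2) n = 2 * vonM n - 2 * unit1 n; last by lra.
  rewrite -conv_mu1; last by lia.
  rewrite /vonM /conv -!sum_distrl -sum_sub; apply: eq_bigr => d _; lra.
move: (HC' N N0) => /Rabs_le_inv H1 /Rabs_le_inv H2; apply: Rabs_le.
nra.
Qed.

(** * The Mertens function *)

Lemma abel (G phi : nat -> R) (N : nat) : G 0%N = 0 -> (0 < N)%N ->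
  \sum_(1 <= n < N.+1) ((G n - G n.-1) * phi n) =
  G N * phi N + \sum_(1 <= n < N) (G n * (phi n - phi n.+1)).
Proof.
move=> G0; elim: N => // -[_ _|N IH _]; first by rewrite big_nat1 big_geq //= G0; lra.
by rewrite sum_recr IH // [X in _ = _ + X]sum_recr /=; lra.
Qed.

Lemma sum_telescope (h : nat -> R) (a b : nat) : (a <= b)%N ->
  \sum_(a <= n < b) (h n.+1 - h n) = h b - h a.
Proof.
move=> ab; rewrite -(subnKC ab); elim: (b - a)%N => [|k IH].
  by rewrite addn0 big_geq //; lra.
by rewrite addnS big_nat_recr /= ?IH; [lra | lia].
Qed.

Lemma sum_inv_le (N : nat) : (0 < N)%N ->
  \sum_(1 <= n < N.+1) / INR n <= 1 + lnN N.
Proof.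
elim: N => // -[_ _|N IH _]; first by rewrite big_nat1 /lnN /= ln_1; lra.
by rewrite sum_recr; have := IH isT; have := @lnN_step N.+1 isT; lra.
Qed.

Definition Mert (N : nat) : R := \sum_(1 <= n < N.+1) mu n.
Definition aMert (N : nat) : R := Rabs (Mert N).

Lemma Mert0 : Mert 0 = 0.
Proof. by rewrite /Mert big_geq. Qed.

Lemma aMert0 : aMert 0 = 0.
Proof. by rewrite /aMert Mert0 Rabs_R0. Qed.

Lemma Mert_step (n : nat) : Mert n.+1 - Mert n = mu n.+1.
Proof. by rewrite /Mert sum_recr; lra. Qed.

Lemma aMert_step (n : nat) : Rabs (aMert n.+1 - aMert n) <= 1.
Proof.
apply: Rle_trans (Rabs_triang_inv2 _ _) _; rewrite Mert_step; exact: mu_bound.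
Qed.

Lemma aMert_ge0 (n : nat) : 0 <= aMert n.
Proof. exact: Rabs_pos. Qed.

Lemma aMert_le (n : nat) : aMert n <= INR n.
Proof.
rewrite -sum_1; apply: sum_abs_le => i _; exact: mu_bound.
Qed.

Lemma aMert_diff (n k : nat) : aMert (n + k)%N <= aMert n + INR k.
Proof.
elim: k => [|k IH]; first by rewrite addn0 /=; lra.
by rewrite addnS S_INR; have /Rabs_le_inv := aMert_step (n + k)%N; lra.
Qed.

Lemma lnN_mono (m n : nat) : (0 < m <= n)%N -> lnN m <= lnN n.
Proof. by move=> H; apply: ln_le_mono; [apply: INR_pos | apply: le_INR]; lia. Qed.

Lemma lnN_mul (m n : nat) : (0 < m)%N -> (0 < n)%N -> lnN (m * n) = lnN m + lnN n.
Proof. by move=> H1 H2; rewrite /lnN mult_INR ln_mult //; apply: INR_pos. Qed.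

(** [vonM2] is understood only through its summatory function. After the triangle inequality,
    [aMert] is therefore written as the sum of its increments, and commutativity moves the summation
    onto [vonM2]. *)
Lemma sum_mu_ln2_le (N : nat) :
  Rabs (\sum_(1 <= n < N.+1) lnmul (lnmul mu) n) <=
  \sum_(1 <= n < N.+1)
     ((aMert n - aMert n.-1) * \sum_(1 <= k < (N %/ n).+1) vonM2 k).
Proof.
pose g k := conv vonM vonM k - lnmul vonM k.
have -> : \sum_(1 <= n < N.+1) lnmul (lnmul mu) n =
          \sum_(1 <= k < N.+1) (g k * Mert (N %/ k)).
  rewrite -sum_conv1; apply: eq_big_nat => n Hn.
  by rewrite lnmul2_mu; [apply: convC | ]; lia.
apply: (@Rle_trans _ (\sum_(1 <= k < N.+1) (vonM2 k * aMert (N %/ k)))).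
  apply: sum_abs_le => k Hk; rewrite Rabs_mult.
  by apply: Rmult_le_compat_r; [exact: Rabs_pos | apply: vonM_diff_le; lia].
have HG k : aMert k = \sum_(1 <= n < k.+1) (aMert n - aMert n.-1).
  by elim: k => [|k IH]; [rewrite big_geq // aMert0 | rewrite sum_recr -IH /=; lra].
apply: Req_le; under eq_bigr do rewrite HG.
by rewrite -!sum_conv1; apply: eq_big_nat => n Hn; apply: convC; lia.
Qed.

(** With [y = N / n] and [k] its integer part, [y ln y - k ln k = (y - k) ln y + k (ln y - ln k)] is
    at most [(y - 1) + 1]; doubled, this is the [2] in [C + 2]. *)
Lemma sum_vonM2_floor : exists C, 0 <= C /\ forall N n, (0 < n <= N)%N ->
  Rabs (\sum_(1 <= k < (N %/ n).+1) vonM2 k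
        - 2 * (INR N / INR n) * (lnN N - lnN n)) <= C * (INR N / INR n).
Proof.
have [C [C0 HC]] := selberg; exists (C + 2); split; first by lra.
move=> N n HnN; have n0 : (0 < n)%N by lia.
have k0 : (0 < N %/ n)%N by rewrite divn_gt0; lia.
have := HC _ k0; move: (\sum_(1 <= k < _) _) => S /Rabs_le_inv HS.
have Hk1 := INR_divn_le N n0; have Hk2 := INR_divn_gt N n0.
have Hk := INR_pos k0; have Hn := INR_pos n0.
have HN : 0 < INR N by apply: INR_pos; lia.
have -> : lnN N - lnN n = ln (INR N / INR n).
  by rewrite /lnN /Rdiv ln_mult ?ln_Rinv //; exact: Rinv_0_lt_compat.
move: Hk1 Hk2 HS; rewrite /lnN; have k1 := INR_ge1 k0; move: (INR N / INR n) (INR (N %/ n)) Hk k1 => y k Hk k1 ky yk HS.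
have y0 : 0 < y by lra.
have Ly : 0 <= ln y by rewrite -ln_1; apply: ln_le_mono; lra.
have L1 := ln_le_sub1 y0; have L2 := ln_le_mono Hk ky.
have L3 : k * (ln y - ln k) <= y - k.
  have /ln_le_sub1 : 0 < y / k by apply: Rdiv_lt_0_compat.
  rewrite /Rdiv ln_mult ?ln_Rinv //; last exact: Rinv_0_lt_compat.
  have Ek : k * / k = 1 by apply: Rinv_r; lra.
  move=> H; have : k * (ln y - ln k) <= k * (y * / k - 1) by apply: Rmult_le_compat_l; lra.
  have -> : k * (y * / k - 1) = y * (k * / k) - k by ring.
  by rewrite Ek; lra.
have L4 : 0 <= k * (ln y - ln k) by apply: Rmult_le_pos; lra.
have L5 : 0 <= (y - k) * ln y <= 1 * ln y.
  by split; [apply: Rmult_le_pos; lra | apply: Rmult_le_compat_r; lra].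
have L6 : C * k <= C * y by apply: Rmult_le_compat_l; lra.
apply: Rabs_le; lra.
Qed.

Lemma lnN1 : lnN 1 = 0.
Proof. exact: ln_1. Qed.

(** Equals [1/n - 1/(n + 1)], the weight that partial summation against [1/n] produces. Thus
    [aMert n * wt n] is [|M(n)|/n] with the logarithmic weight [1/(n + 1)]. *)
Definition wt (n : nat) : R := / (INR n * INR n.+1).

Lemma wt_gt0 (n : nat) : (0 < n)%N -> 0 < wt n.
Proof.
by move=> n0; apply/Rinv_0_lt_compat/Rmult_lt_0_compat; apply: INR_pos.
Qed.

Lemma wt_sub (n : nat) : (0 < n)%N -> wt n = / INR n - / INR n.+1.
Proof. by move=> n0; have := INR_pos n0; rewrite /wt S_INR => H; field; lra. Qed.

Lemma INR_wt (n : nat) : (0 < n)%N -> INR n * wt n = / INR n.+1.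
Proof. by move=> n0; have := INR_pos n0; rewrite /wt S_INR => H; field; lra. Qed.

(** [ln^2 N - ln^2 n] is at most [2 ln N (ln N - ln n)], and the sum of [ln N - ln n] over [n <= N]
    is only [O(N)]. *)
Lemma Mert_ln2 (N : nat) : (0 < N)%N ->
  Rabs (Mert N * (lnN N * lnN N) - \sum_(1 <= n < N.+1) lnmul (lnmul mu) n) <=
  6 * INR N * lnN N.
Proof.
move=> N0; rewrite /Mert Rmult_comm -sum_distrl -sum_sub.
apply: (@Rle_trans _ (\sum_(1 <= n < N.+1) (2 * lnN N * (lnN N - lnN n)))).
  apply: sum_abs_le => n Hn.
  have -> : lnN N * lnN N * mu n - lnmul (lnmul mu) n =
            mu n * ((lnN N + lnN n) * (lnN N - lnN n)).
    by rewrite /lnmul -/(lnN n); ring.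
  have H1 : lnN n <= lnN N by apply: lnN_mono; lia.
  have H2 : 0 <= lnN n by apply: lnN_ge0; lia.
  rewrite Rabs_mult (Rabs_pos_eq (_ * _)); last by apply: Rmult_le_pos; lra.
  rewrite -[X in _ <= X]Rmult_1_l; apply: Rmult_le_compat; try exact: Rabs_pos.
  - by apply: Rmult_le_pos; lra.
  - exact: mu_bound.
  - by apply: Rmult_le_compat_r; lra.
rewrite sum_distrl sum_sub; have -> : \sum_(1 <= n < N.+1) lnN N = lnN N * INR N.
  by rewrite -sum_1 -sum_distrl; apply: eq_bigr => n _; lra.
have /Rabs_le_inv := sum_lnN N0; have := lnN_ge0 N0.
have := sqrt_INR_ge1 N0; have := sqr_sqrt_INR N; move: (sqrt _) => r Hr r1 L0 HS.
have : r <= INR N by nra.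
move=> HrN; have : 0 <= lnN N * (3 * INR N -
   (lnN N * INR N - \sum_(1 <= n < N.+1) lnN n)) by apply: Rmult_le_pos; lra.
lra.
Qed.

(** Divided by [N ln^2 N], this bounds [|M(N)|/N] by a mean of [|M(n)|/n] with weights
    [2 (ln N - ln n) / ((n + 1) ln^2 N)], of total mass tending to 1. *)
Lemma aMert_ln2_le : exists C, 0 <= C /\ forall N, (0 < N)%N ->
  aMert N * (lnN N * lnN N) <=
  2 * INR N * \sum_(1 <= n < N) (aMert n * wt n * (lnN N - lnN n))
  + C * INR N * (1 + lnN N).
Proof.
have [C [C0 HC]] := sum_vonM2_floor; exists (C + 8); split; first by lra.
move=> N N0; have HN := INR_pos N0; have L0 := lnN_ge0 N0.
pose phi n := 2 * (INR N / INR n) * (lnN N - lnN n).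
have E1 : aMert N * (lnN N * lnN N) <=
    \sum_(1 <= n < N.+1)
      ((aMert n - aMert n.-1) * \sum_(1 <= k < (N %/ n).+1) vonM2 k)
    + 6 * INR N * lnN N.
  have := Mert_ln2 N0; have := sum_mu_ln2_le N.
  move: (\sum_(1 <= n < N.+1) lnmul _ n) => S H1 H2.
  have <- : Rabs (Mert N * (lnN N * lnN N)) = aMert N * (lnN N * lnN N).
    by rewrite Rabs_mult (Rabs_pos_eq (_ * _)) //; nra.
  have := Rabs_triang_inv (Mert N * (lnN N * lnN N)) S; lra.
(* The increments of [aMert] are at most 1 in size, so the errors [C * N / n] of [sum_vonM2_floor]
   add up to at most [C * N * (1 + ln N)]. *)
have E2 : \sum_(1 <= n < N.+1)
      ((aMert n - aMert n.-1) * \sum_(1 <= k < (N %/ n).+1) vonM2 k) <=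
    \sum_(1 <= n < N.+1) ((aMert n - aMert n.-1) * phi n)
    + C * INR N * (1 + lnN N).
  apply: (@Rle_trans _ (\sum_(1 <= n < N.+1)
      ((aMert n - aMert n.-1) * phi n + C * INR N * / INR n))).
    apply: sum_le => n Hn.
    have := HC N n ltac:(lia); rewrite -/(phi n).
    move: (\sum_(1 <= k < _) _) => S HS.
    have HD : Rabs (aMert n - aMert n.-1) <= 1.
      by case: n Hn {HS} => // n _; exact: aMert_step.
    suff : (aMert n - aMert n.-1) * (S - phi n) <= C * INR N * / INR n by lra.
    apply: Rle_trans (Rle_abs _) _; rewrite Rabs_mult -[X in _ <= X]Rmult_1_l.
    apply: Rmult_le_compat => //; try exact: Rabs_pos.
    by rewrite /Rdiv in HS; lra.
  rewrite sum_add sum_distrl; apply: Rplus_le_compat_l.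
  by apply: Rmult_le_compat_l; [apply: Rmult_le_pos; lra | exact: sum_inv_le].
have E3 : \sum_(1 <= n < N.+1) ((aMert n - aMert n.-1) * phi n) <=
    2 * INR N * \sum_(1 <= n < N) (aMert n * wt n * (lnN N - lnN n))
    + 2 * INR N * (1 + lnN N).
  rewrite abel //; last exact: aMert0.
  have -> : phi N = 0 by rewrite /phi; lra.
  have H : \sum_(1 <= n < N) / INR n.+1 <= 1 + lnN N.
    apply: (@Rle_trans _ (\sum_(1 <= n < N) (lnN n.+1 - lnN n))).
      by apply: sum_le => n Hn; have := @lnN_step n ltac:(lia); lra.
    by rewrite sum_telescope // lnN1; lra.
  apply: (@Rle_trans _ (\sum_(1 <= n < N)
      (2 * INR N * (aMert n * wt n * (lnN N - lnN n)) + 2 * INR N * / INR n.+1))).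
    rewrite Rmult_0_r Rplus_0_l; apply: sum_le => n Hn.
    have n0 : (0 < n)%N by lia.
    have Hn1 := INR_pos n0; have [_ Hd] := lnN_step n0.
    have Hn2 : 0 < INR n.+1 by apply: INR_pos.
    have W := wt_gt0 n0.
    (* The change of [1 / n] gives the main term; the change of [ln n] is smaller, and the trivial
       [aMert n <= n] is enough for it. *)
    have -> : phi n - phi n.+1 = 2 * INR N * (wt n * (lnN N - lnN n))
               + 2 * INR N * (/ INR n.+1 * (lnN n.+1 - lnN n)).
      by rewrite wt_sub // /phi; field; lra.
    rewrite Rmult_plus_distr_l; apply: Rplus_le_compat; first by apply: Req_le; ring.
    have -> : aMert n * (2 * INR N * (/ INR n.+1 * (lnN n.+1 - lnN n))) =
              2 * INR N * / INR n.+1 * (aMert n * (lnN n.+1 - lnN n)) by ring.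
    rewrite -[X in _ <= X]Rmult_1_r; apply: Rmult_le_compat_l.
      by apply: Rmult_le_pos; [lra | exact/Rlt_le/Rinv_0_lt_compat].
    have -> : 1 = INR n * / INR n by rewrite Rinv_r; lra.
    apply: Rmult_le_compat; [exact: aMert_ge0 | | exact: aMert_le | by []].
    by have := @lnN_mono n n.+1 ltac:(lia); lra.
  rewrite sum_add !sum_distrl; apply: Rplus_le_compat_l.
  by apply: Rmult_le_compat_l; lra.
have : INR N * lnN N <= INR N * (1 + lnN N) by apply: Rmult_le_compat_l; lra.
lra.
Qed.

Definition Usum (N : nat) : R := \sum_(1 <= n < N.+1) (aMert n * wt n).

Lemma Usum0 : Usum 0 = 0.
Proof. by rewrite /Usum big_geq. Qed.

Lemma Usum_step (n : nat) : Usum n.+1 - Usum n = aMert n.+1 * wt n.+1.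
Proof. by rewrite /Usum sum_recr; lra. Qed.

Lemma Usum_mono (m n : nat) : (m <= n)%N -> Usum m <= Usum n.
Proof.
move=> mn; rewrite -(subnKC mn); elim: (n - m)%N => [|k IH]; first by rewrite addn0; lra.
rewrite addnS; have := Usum_step (m + k)%N; have := aMert_ge0 (m + k).+1.
by have := @wt_gt0 (m + k).+1 isT; nra.
Qed.

(** A bound [b] on the logarithmic mean of [|M(n)|/n]; the constant [C] disappears after division by
    [ln n]. *)
Definition log_mean_le (b : R) : Prop :=
  exists C, forall n, (0 < n)%N -> Usum n <= b * lnN n + C.

Lemma lnN_unbounded (x : R) : exists N0, (0 < N0)%N /\ forall N, (N0 <= N)%N -> x <= lnN N.
Proof.
have [N0 HN0] := INR_unbounded (exp x); exists N0.+1; split=> // N HN.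
rewrite -(ln_exp x); apply: ln_le_mono; first exact: exp_pos.
by have : INR N0 <= INR N by [apply: le_INR; lia]; lra.
Qed.

(** Partial summation bounds the sum in [aMert_ln2_le] by the integral of [b u + C] over [u] from 0
    to [ln N], whose primitive is [h] below. The leading term [b / 2 * ln^2 N] is doubled by the
    inequality, which restores [b]. *)
Lemma aMert_le_of_log_mean (b e : R) : 0 <= b -> 0 < e -> log_mean_le b ->
  exists N0, forall N, (N0 <= N)%N -> aMert N <= (b + e) * INR N.
Proof.
move=> b0 e0 [C1 HU].
pose C := Rmax C1 0; have C0 : 0 <= C by apply: Rmax_r.
have {}HU n : (0 < n)%N -> Usum n <= b * lnN n + C.
  by move=> n0; have := HU n n0; have := Rmax_l C1 0; rewrite -/C; lra.
have [D [D0 HD]] := aMert_ln2_le.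
have [N1 [N10 HN1]] := lnN_unbounded (1 + 2 * (2 * C + D) / e).
exists N1 => N HN; have N0 : (0 < N)%N by lia.
have HL := HN1 N HN; have HN0 := INR_pos N0.
have HS : \sum_(1 <= n < N) (aMert n * wt n * (lnN N - lnN n)) <=
          b / 2 * (lnN N * lnN N) + C * lnN N.
  have -> : \sum_(1 <= n < N) (aMert n * wt n * (lnN N - lnN n)) =
     \sum_(1 <= n < N.+1) ((Usum n - Usum n.-1) * (lnN N - lnN n)).
    rewrite [RHS]big_nat_recr //= Rminus_diag Rmult_0_r Rplus_0_r.
    apply: eq_big_nat => -[|n] // Hn; by rewrite -Usum_step.
  rewrite abel ?Usum0 // Rminus_diag Rmult_0_r Rplus_0_l.
  pose h n := b / 2 * (lnN n * lnN n) + C * lnN n.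
  apply: (@Rle_trans _ (\sum_(1 <= n < N) (h n.+1 - h n))).
    apply: sum_le => n Hn; have n0 : (0 < n)%N by lia.
    have Hd : 0 <= lnN n.+1 - lnN n by have := @lnN_mono n n.+1 ltac:(lia); lra.
    have -> : lnN N - lnN n - (lnN N - lnN n.+1) = lnN n.+1 - lnN n by ring.
    apply: (@Rle_trans _ ((b * lnN n + C) * (lnN n.+1 - lnN n))).
      by apply: Rmult_le_compat_r => //; apply: HU.
    have -> : h n.+1 - h n = (b * lnN n + C) * (lnN n.+1 - lnN n) +
       b / 2 * ((lnN n.+1 - lnN n) * (lnN n.+1 - lnN n)) by rewrite /h; field.
    have : 0 <= b / 2 * ((lnN n.+1 - lnN n) * (lnN n.+1 - lnN n)).
      by apply: Rmult_le_pos; [lra | apply: Rmult_le_pos].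
    lra.
  by rewrite sum_telescope // /h lnN1; lra.
have Hq : 0 <= 2 * (2 * C + D) / e.
  by apply: Rmult_le_pos; [lra | exact/Rlt_le/Rinv_0_lt_compat].
have L1 : 1 <= lnN N by lra.
have HeL : 2 * (2 * C + D) <= e * lnN N.
  have -> : 2 * (2 * C + D) = e * (2 * (2 * C + D) / e) by field; lra.
  by apply: Rmult_le_compat_l; lra.
apply: (Rmult_le_reg_r (lnN N * lnN N)); first by nra.
apply: Rle_trans (HD N N0) _.
have : 2 * INR N * \sum_(1 <= n < N) (aMert n * wt n * (lnN N - lnN n)) <=
       2 * INR N * (b / 2 * (lnN N * lnN N) + C * lnN N).
  by apply: Rmult_le_compat_l; lra.
suff : INR N * (2 * C * lnN N + D * (1 + lnN N)) <= INR N * (e * (lnN N * lnN N)).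
  by move=> H1 H2; apply: Rle_trans (Rplus_le_compat_r _ _ _ H2) _; lra.
apply: Rmult_le_compat_l; first by lra.
apply: (@Rle_trans _ (2 * (2 * C + D) * lnN N)); first by nra.
by rewrite -Rmult_assoc; apply: Rmult_le_compat_r; lra.
Qed.

(** The sum equals that of [mu(n)/n] minus [M(N)/N]. Also [N] times the sum of [mu(n)/n] differs
    from [sum_mu_floor], which is 1, by at most [N]; the three contributions give [3]. *)
Lemma sum_Mert_wt (N : nat) : (0 < N)%N ->
  Rabs (\sum_(1 <= n < N) (Mert n * wt n)) <= 3.
Proof.
move=> N0; have HN := INR_pos N0.
have E1 : \sum_(1 <= n < N.+1) (mu n * / INR n) =
          Mert N * / INR N + \sum_(1 <= n < N) (Mert n * wt n).
  rewrite (eq_big_nat _ _ (F2 := fun n => (Mert n - Mert n.-1) * / INR n)).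
    rewrite abel ?Mert0 //; congr (_ + _).
    by apply: eq_big_nat => n Hn; rewrite wt_sub //; lia.
  by case=> // n _; rewrite Mert_step.
have E2 : INR N * \sum_(1 <= n < N.+1) (mu n * / INR n) =
   1 + \sum_(1 <= n < N.+1) (mu n * (INR N / INR n - INR (N %/ n))).
  rewrite -[X in X + _](sum_mu_floor N0) -sum_add -sum_distrl.
  by apply: eq_bigr => n _; rewrite /Rdiv; ring.
have E3 : Rabs (\sum_(1 <= n < N.+1) (mu n * (INR N / INR n - INR (N %/ n)))) <= INR N.
  rewrite -[X in _ <= X]sum_1; apply: sum_abs_le => n Hn; rewrite Rabs_mult -(Rmult_1_r 1).
  have n0 : (0 < n)%N by lia.
  apply: Rmult_le_compat; try exact: Rabs_pos; first exact: mu_bound.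
  by have := INR_divn_le N n0; have := INR_divn_gt N n0 => H1 H2; apply: Rabs_le; lra.
have E4 : Rabs (Mert N) <= INR N by apply: aMert_le.
have -> : \sum_(1 <= n < N) (Mert n * wt n) =
   (1 + \sum_(1 <= n < N.+1) (mu n * (INR N / INR n - INR (N %/ n))) - Mert N) * / INR N.
  rewrite -E2 E1; field; lra.
rewrite Rabs_mult (Rabs_pos_eq (/ _)); last exact/Rlt_le/Rinv_0_lt_compat.
apply: (Rmult_le_reg_r (INR N)) => //; rewrite Rmult_assoc Rinv_l; last by lra.
have := INR_ge1 N0; move/Rabs_le_inv: E3; move/Rabs_le_inv: E4 => H1 H2 H3.
by rewrite Rmult_1_r; apply: Rabs_le; lra.
Qed.

Lemma sum_inv_window (p L : nat) : (0 < p)%N -> (0 < L)%N ->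
  lnN L / 2 <= \sum_(p <= j < L * p) / INR j.+1 <= lnN L.
Proof.
move=> p0 L0; have pL : (p <= L * p)%N by rewrite leq_pmull.
have HL : lnN L = \sum_(p <= j < L * p) (lnN j.+1 - lnN j).
  by rewrite sum_telescope // lnN_mul //; ring.
split; last first.
  by rewrite HL; apply: sum_le => j Hj; have := @lnN_step j ltac:(lia); lra.
rewrite HL /Rdiv Rmult_comm -sum_distrl; apply: sum_le => j Hj.
have j0 : (0 < j)%N by lia.
have [_ H] := lnN_step j0; have H1 := INR_ge1 j0.
suff : / INR j <= 2 * / INR j.+1 by lra.
have -> : 2 * / INR j.+1 = / (INR j.+1 / 2) by field; have := INR_pos (ltn0Sn j); lra.
by apply: Rinv_le_contravar; rewrite ?S_INR; lra.
Qed.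

(* Otherwise [M] would keep a constant sign on [[p, L p)], since it moves by
   steps of size at most 1, and [sum M(j) / (j (j + 1))] would be unbounded. *)
Lemma aMert_small (a : R) : 0 < a ->
  exists L P, (1 < L)%N /\ (0 < P)%N /\ forall p, (P <= p)%N ->
    exists j, (p <= j < L * p)%N /\ aMert j <= a * INR j.
Proof.
move=> a0.
(* With constant sign the window sum has size at least [a * ln L / 2]; it is also at most 6, as a
   difference of two sums bounded by 3. Hence [ln L > 12 / a] is contradictory. *)
have [L [L0 HL]] := lnN_unbounded (12 / a + 1).
have L1 : (1 < L)%N.
  case: (ltnP 1 L) => // H; have := HL L (leqnn _).
  have -> : L = 1%N by lia.
  have : 0 < 12 / a by apply: Rdiv_lt_0_compat; lra.
  by rewrite lnN1; lra.
(* From [1 / a] on, [aMert j > a * j] exceeds 1, so a step of size at most 1 cannot change the sign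
   of [M]. *)
have [P HP] := INR_unbounded (1 / a).
exists L, P.+1; do 2!split=> // ; move=> p Hp.
case: (Classical_Prop.classic (exists j, (p <= j < L * p)%N /\ aMert j <= a * INR j)) => // Hno.
have {}Hno j : (p <= j < L * p)%N -> a * INR j < aMert j.
  by move=> Hj; apply: Rnot_le_lt => H; apply: Hno; exists j.
have pL : (p < L * p)%N by rewrite -{1}(mul1n p) ltn_pmul2r; lia.
have Hap j : (p <= j)%N -> 1 <= a * INR j.
  move=> Hj; have -> : 1 = a * (1 / a) by field; lra.
  apply: Rmult_le_compat_l; first lra.
  by have : INR P <= INR j by [apply: le_INR; lia]; lra.
have [s [Hs Hsp]] : exists s, Rabs s = 1 /\ 0 < s * Mert p.
  have := Hno p ltac:(lia); rewrite /aMert; have := Hap p (leqnn _).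
  case: (Rle_dec 0 (Mert p)) => H1 H2.
    by rewrite Rabs_pos_eq // => H3; exists 1; split; [exact: Rabs_R1 | lra].
  rewrite Rabs_left ?Rabs_R1; last by lra.
  by move=> H3; exists (-1); rewrite Rabs_Ropp Rabs_R1; lra.
have Hsj k : (p + k < L * p)%N -> s * Mert (p + k) = aMert (p + k).
  have Hpos : 0 < s * Mert (p + k) -> s * Mert (p + k) = aMert (p + k).
    by move=> H; rewrite /aMert -(Rmult_1_l (Rabs _)) -Hs -Rabs_mult Rabs_pos_eq //; lra.
  elim: k Hpos => [|k IH] Hpos Hk; first by apply: Hpos; rewrite addn0.
  apply: Hpos; rewrite addnS.
  have -> : s * Mert (p + k).+1 = s * Mert (p + k) + s * mu (p + k).+1.
    by rewrite -Mert_step; ring.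
  have Hk1 : (p + k < L * p)%N by lia.
  have H0 : 0 < s * Mert (p + k) -> s * Mert (p + k) = aMert (p + k).
    by move=> H; rewrite /aMert -(Rmult_1_l (Rabs _)) -Hs -Rabs_mult Rabs_pos_eq //; lra.
  rewrite (IH H0 Hk1).
  have := Hno (p + k)%N ltac:(lia); have := Hap (p + k)%N ltac:(lia).
  have : Rabs (s * mu (p + k).+1) <= 1 by rewrite Rabs_mult Hs Rmult_1_l; exact: mu_bound.
  by move=> /Rabs_le_inv; lra.
have p0 : (0 < p)%N by lia.
have E1 : s * \sum_(p <= j < L * p) (Mert j * wt j) >= a * (lnN L / 2).
  apply: Rle_ge; apply: (@Rle_trans _ (a * \sum_(p <= j < L * p) / INR j.+1)).
    by apply: Rmult_le_compat_l; [lra | have := sum_inv_window p0 L0; lra].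
  rewrite -!sum_distrl; apply: sum_le => j Hj.
  rewrite -Rmult_assoc -(@INR_wt j); last by lia.
  rewrite -Rmult_assoc; apply: Rmult_le_compat_r; first by apply/Rlt_le/wt_gt0; lia.
  have := Hsj (j - p)%N; rewrite subnKC; last by lia.
  by move=> ->; [apply/Rlt_le/Hno | ]; lia.
have E2 : \sum_(p <= j < L * p) (Mert j * wt j) =
   \sum_(1 <= j < L * p) (Mert j * wt j) - \sum_(1 <= j < p) (Mert j * wt j).
  by rewrite [in RHS](@sum_cat 1 p (L * p)); [lra | lia].
have /Rabs_le_inv := sum_Mert_wt p0.
have /Rabs_le_inv : Rabs (\sum_(1 <= j < L * p) (Mert j * wt j)) <= 3.
  by apply: sum_Mert_wt; lia.
have : Rabs (s * \sum_(p <= j < L * p) (Mert j * wt j)) <= Rabs (\sum_(p <= j < L * p) (Mert j * wt j)).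
  by rewrite Rabs_mult Hs; lra.
move=> /Rabs_le_inv H1 H2 H3.
have H4 : Rabs (\sum_(p <= j < L * p) (Mert j * wt j)) <= 6 by rewrite E2; apply: Rabs_le; lra.
have := HL L (leqnn _).
have : a * (12 / a + 1) = 12 + a by field; lra.
move=> H5 H6; have : a * (12 / a + 1) <= a * lnN L by apply: Rmult_le_compat_l; lra.
lra.
Qed.

(** After a point [j0] with [aMert j0 <= a / 2 * j0], unit steps keep [aMert j <= 3 * a / 4 * j] on
    a run of length proportional to [j0]. There each term falls short of the bound for [al] by at
    least [a / 4 / (j + 1)]. The total saving is uniform in [p] and in [al >= a]. *)
Lemma window_saving (a : R) : 0 < a -> exists L P (k : R),
  (1 < L)%N /\ (0 < P)%N /\ 0 < k /\
  forall p al, (P <= p)%N -> a <= al ->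
    (forall j, (p <= j)%N -> aMert j <= al * INR j) ->
    \sum_(p <= j < L * p) (aMert j * wt j) <= al * lnN L - k.
Proof.
move=> a0; have [L1 [P [HL1 [P0 HP]]]] := @aMert_small (a / 2) ltac:(lra).
have [q [Hq q0]] := @archimed_cor1 (a / 4) ltac:(lra).
have Hq0 : 0 < INR q by apply: lt_0_INR; lia.
have qpos : (0 < q)%N by lia.
(* As [h <= j0], the doubled window contains the run [[j0, j0 + h)]; [p >= 2 * q] gives
   [h >= j0 / (2 * q)]. Each of these [h] terms saves at least [a / 4 / (2 * j0)], in total
   [a / (16 * q)]. *)
exists (2 * L1)%N, (P + 2 * q)%N, (a / (16 * INR q)).
have k0 : 0 < a / (16 * INR q) by apply: Rdiv_lt_0_compat; lra.
split; first by lia.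
split; first by lia.
split=> // p al Hp Hal Hj.
have p0 : (0 < p)%N by lia.
have [j0 [Hj0 Hsm]] := HP p ltac:(lia).
have j00 : (0 < j0)%N by lia.
have Hj0p := INR_pos j00.
set h := (j0 %/ q)%N.
have hj0 : (h <= j0)%N by apply: leq_div.
have Hh1 : INR h <= a / 4 * INR j0.
  apply: Rle_trans (INR_divn_le j0 qpos) _; rewrite /Rdiv Rmult_comm.
  by apply: Rmult_le_compat_r; rewrite /Rdiv in Hq; lra.
have Hh2 : INR j0 / (2 * INR q) <= INR h.
  have := INR_divn_gt j0 qpos; rewrite -/h => H1.
  have H2 : 2 * INR q <= INR j0.
    by rewrite -[2]/(INR 2) -mult_INR; apply: le_INR; lia.
  have H3 : 2 <= INR j0 / INR q.
    apply: (Rmult_le_reg_r (INR q)) => //; rewrite /Rdiv Rmult_assoc Rinv_l; lra.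
  have -> : INR j0 / (2 * INR q) = INR j0 / INR q / 2 by field; lra.
  lra.
have Hdef : \sum_(p <= j < 2 * L1 * p) (al * / INR j.+1 - aMert j * wt j) >= a / (16 * INR q).
  have Hterm j : (p <= j)%N -> 0 <= al * / INR j.+1 - aMert j * wt j.
    move=> H; have j1 : (0 < j)%N by lia.
    rewrite -(INR_wt j1) -Rmult_assoc; have := wt_gt0 j1; have := Hj j H.
    by nra.
  have Hend : (j0 + h <= 2 * L1 * p)%N by rewrite -mulnA; lia.
  rewrite (@sum_cat p j0); last by lia.
  rewrite (@sum_cat j0 (j0 + h)); last by lia.
  have S1 : 0 <= \sum_(p <= j < j0) (al * / INR j.+1 - aMert j * wt j).
    by apply: sum_ge0 => j H; apply: Hterm; lia.
  have S3 : 0 <= \sum_(j0 + h <= j < 2 * L1 * p) (al * / INR j.+1 - aMert j * wt j).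
    by apply: sum_ge0 => j H; apply: Hterm; lia.
  suff : a / (16 * INR q) <= \sum_(j0 <= j < j0 + h) (al * / INR j.+1 - aMert j * wt j) by lra.
  apply: (@Rle_trans _ (\sum_(j0 <= j < j0 + h) (a / 4 * / (2 * INR j0)))).
    rewrite big_const_nat addKn.
    have -> : iter h (Rplus (a / 4 * / (2 * INR j0))) 0 = INR h * (a / 4 * / (2 * INR j0)).
      by elim: (h) => [|m IH]; [rewrite /=; lra | rewrite iterS IH S_INR; ring].
    have -> : a / (16 * INR q) = INR j0 / (2 * INR q) * (a / 4 * / (2 * INR j0)).
      by field; lra.
    apply: Rmult_le_compat_r => //; apply: Rmult_le_pos; first by lra.
    by apply/Rlt_le/Rinv_0_lt_compat; lra.
  apply: sum_le => j H; have j1 : (0 < j)%N by lia.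
  rewrite -(INR_wt j1) -Rmult_assoc -Rmult_minus_distr_r.
  have Hjj : INR j0 <= INR j by apply: le_INR; lia.
  have HG : aMert j <= 3 * a / 4 * INR j.
    have := aMert_diff j0 (j - j0); rewrite subnKC; last by lia.
    have : INR (j - j0) <= INR h by apply: le_INR; lia.
    move=> H1 H2; have : 3 * a / 4 * INR j0 <= 3 * a / 4 * INR j.
      by apply: Rmult_le_compat_l; lra.
    lra.
  have HD : a / 4 * INR j <= al * INR j - aMert j.
    by have : a * INR j <= al * INR j by [apply: Rmult_le_compat_r; lra]; lra.
  apply: (@Rle_trans _ (a / 4 * INR j * wt j)).
    rewrite Rmult_assoc INR_wt //; apply: Rmult_le_compat_l; first lra.
    apply: Rinv_le_contravar; first exact: INR_pos.
    by rewrite -[2]/(INR 2) -mult_INR; apply: le_INR; lia.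
  by apply: Rmult_le_compat_r => //; apply/Rlt_le/wt_gt0.
move: Hdef; rewrite sum_sub sum_distrl.
have [_ H1] := @sum_inv_window p (2 * L1) p0 ltac:(lia).
have : al * \sum_(p <= j < 2 * L1 * p) / INR j.+1 <= al * lnN (2 * L1).
  by apply: Rmult_le_compat_l; lra.
lra.
Qed.

(** The windows [[L^i p0, L^(i+1) p0)] tile the integers from [p0] on, and each has logarithmic
    length [ln L]; a saving [k0] in each lowers the mean by [k0 / ln L]. *)
Lemma log_mean_saving (a : R) : 0 < a -> exists k : R, 0 < k <= a /\
  forall al, a <= al ->
    (exists N0, forall N, (N0 <= N)%N -> aMert N <= al * INR N) ->
    log_mean_le (al - k).
Proof.
move=> a0; have [L [P [k0 [L1 [P0 [k00 HW]]]]]] := window_saving a0.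
have HL : 0 < lnN L by rewrite -lnN1; apply: ln_increasing; [exact: INR_pos | apply: lt_INR; lia].
have Hk : 0 < k0 / lnN L by apply: Rdiv_lt_0_compat.
(* The minimum keeps [al - k] nonnegative for every [al >= a]. *)
exists (Rmin (k0 / lnN L) a).
have Hm1 := Rmin_l (k0 / lnN L) a; have Hm2 := Rmin_r (k0 / lnN L) a.
split; first by split=> //; apply: Rmin_glb_lt.
move=> al Hal [N0 HN0]; set b := al - _; have b0 : 0 <= b by rewrite /b; lra.
pose p0 := (P + N0)%N; have p00 : (0 < p0)%N by rewrite /p0; lia.
pose U m := \sum_(1 <= j < m) (aMert j * wt j).
have HU i : U (L ^ i * p0)%N <= U p0 + INR i * (b * lnN L).
  elim: i => [|i IH]; first by rewrite mul1n /=; lra.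
  have Hi : (p0 <= L ^ i * p0)%N by rewrite leq_pmull // expn_gt0; lia.
  rewrite expnS -mulnA /U (@sum_cat 1 (L ^ i * p0)); last by nia.
  have := HW (L ^ i * p0)%N al ltac:(rewrite /p0 in Hi *; lia) Hal.
  move=> /(_ ltac:(move=> j H; apply: HN0; rewrite /p0 in Hi; lia)).
  rewrite S_INR -/(U (L ^ i * p0)%N) -/(U p0).
  have : al * lnN L - k0 <= b * lnN L.
    have -> : al * lnN L - k0 = (al - k0 / lnN L) * lnN L by field; lra.
    by apply: Rmult_le_compat_r; rewrite /b; lra.
  lra.
exists (U p0 + b * lnN L) => n n0.
case: (ltnP n p0) => Hn.
  have : Usum n <= Usum p0.-1 by apply: Usum_mono; lia.
  rewrite /Usum prednK // -/(U p0); have := lnN_ge0 n0 => H1 H2.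
  have : 0 <= b * lnN n by apply: Rmult_le_pos.
  have : 0 <= b * lnN L by apply: Rmult_le_pos; lra.
  lra.
have m0 : (0 < n %/ p0)%N by rewrite divn_gt0.
have /andP[Hi1 Hi2] := trunc_log_bounds L1 m0.
move: (trunc_log L _) Hi1 Hi2 => i Hi1 Hi2.
have Hlow : (L ^ i * p0 <= n)%N by rewrite -leq_divRL.
have Hup : (n < L ^ i.+1 * p0)%N by rewrite -ltn_divLR.
have H1 : Usum n <= U (L ^ i.+1 * p0)%N.
  have -> : U (L ^ i.+1 * p0)%N = Usum (L ^ i.+1 * p0).-1 by rewrite /Usum prednK //; lia.
  by apply: Usum_mono; lia.
have H2 : INR i * lnN L <= lnN n.
  apply: (@Rle_trans _ (lnN (L ^ i))).
    elim: (i) => [|m IH]; first by rewrite /= lnN1; lra.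
    by rewrite expnS lnN_mul ?expn_gt0 ?(ltnW L1) // S_INR; lra.
  apply: lnN_mono; rewrite expn_gt0 (ltnW L1) /=; apply: leq_trans Hlow.
  by rewrite leq_pmulr.
have := HU i.+1; rewrite S_INR.
have : b * (INR i * lnN L) <= b * lnN n by apply: Rmult_le_compat_l.
lra.
Qed.

(** One round turns a mean bound [b > e / 2] into the pointwise bound [b + k / 2], and this into the
    mean bound [b - k / 2]. Since [k] depends on [e] only, more than [2 / k] rounds starting from 1
    must reach [e / 2]. *)
Theorem mertens_o (e : R) : 0 < e ->
  exists N0, forall N, (N0 <= N)%N -> aMert N <= e * INR N.
Proof.
move=> e0.
suff [b [b0 [be Hb]]] : exists b, 0 <= b /\ b <= e / 2 /\ log_mean_le b.
  have [N0 HN0] := @aMert_le_of_log_mean b (e / 2) b0 ltac:(lra) Hb.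
  exists N0 => N HN; apply: Rle_trans (HN0 N HN) _.
  by apply: Rmult_le_compat_r; [exact: pos_INR | lra].
have [k [[k0 ke] Hk]] := @log_mean_saving (e / 2) ltac:(lra).
have Hit (i : nat) : exists b, 0 <= b /\ log_mean_le b /\
    (b <= e / 2 \/ b <= 1 - INR i * (k / 2)).
  elim: i => [|i [b [b0 [Hb Hb']]]].
    exists 1; split; first lra; split; last by right; rewrite /=; lra.
    exists 1 => n n0; apply: (@Rle_trans _ (\sum_(1 <= j < n.+1) / INR j)).
      apply: sum_le => j Hj; have j0 : (0 < j)%N by lia.
      apply: (@Rle_trans _ (INR j * wt j)).
        by apply: Rmult_le_compat_r; [exact/Rlt_le/wt_gt0 | exact: aMert_le].
      rewrite INR_wt //; apply: Rinv_le_contravar; first exact: INR_pos.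
      by apply: le_INR; lia.
    by have := sum_inv_le n0; lra.
  case: (Rle_dec b (e / 2)) => Hbe; first by exists b; do 2!split=> //; left.
  have [N0 HN0] := @aMert_le_of_log_mean b (k / 2) b0 ltac:(lra) Hb.
  exists (b + k / 2 - k); split; first by lra.
  split; first by apply: Hk; [lra | exists N0].
  by right; rewrite S_INR; case: Hb'; lra.
have [i Hi] := INR_unbounded (2 / k).
have [b [b0 [Hb Hb']]] := Hit i.
exists b; split=> //; split=> //; case: Hb' => // Hb'.
have : 2 / k * (k / 2) <= INR i * (k / 2) by apply: Rmult_le_compat_r; lra.
have -> : 2 / k * (k / 2) = 1 by field; lra.
lra.
Qed.

(** * Complex sums *)

Lemma Cplx_eq (x y : Cplx) : fst x = fst y -> snd x = snd y -> x = y.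
Proof. by case: x y => [a b] [c d] /= -> ->. Qed.

Lemma CaddC (x y : Cplx) : Cadd x y = Cadd y x.
Proof. by apply: Cplx_eq => /=; ring. Qed.

Lemma CaddA (x y z : Cplx) : Cadd x (Cadd y z) = Cadd (Cadd x y) z.
Proof. by apply: Cplx_eq => /=; ring. Qed.

Lemma Cadd0 (x : Cplx) : Cadd Czero x = x.
Proof. by apply: Cplx_eq => /=; ring. Qed.

Lemma CmulDl (x y z : Cplx) : Cmul (Cadd x y) z = Cadd (Cmul x z) (Cmul y z).
Proof. by apply: Cplx_eq => /=; ring. Qed.

Lemma CmulDr (x y z : Cplx) : Cmul x (Cadd y z) = Cadd (Cmul x y) (Cmul x z).
Proof. by apply: Cplx_eq => /=; ring. Qed.

Lemma Cmul0l (x : Cplx) : Cmul Czero x = Czero.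
Proof. by apply: Cplx_eq => /=; ring. Qed.

Lemma Cmul0r (x : Cplx) : Cmul x Czero = Czero.
Proof. by apply: Cplx_eq => /=; ring. Qed.

HB.instance Definition _ := Monoid.isComLaw.Build Cplx Czero Cadd CaddA CaddC Cadd0.
HB.instance Definition _ := Monoid.isMulLaw.Build Cplx Czero Cmul Cmul0l Cmul0r.
HB.instance Definition _ := Monoid.isAddLaw.Build Cplx Cmul Cadd CmulDl CmulDr.

Lemma Cplx_ring : ring_theory Czero Cone Cadd Cmul Csub Copp (@eq Cplx).
Proof. by split=> *; apply: Cplx_eq => /=; ring. Qed.
Add Ring Cplx_ring : Cplx_ring.

Notation "\csum_ ( m <= i < n ) F" := (\big[Cadd/Czero]_(m <= i < n) F)
  (at level 41, F at level 41, i, m, n at level 50,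
   format "'[' \csum_ ( m  <=  i  <  n ) '/  '  F ']'").
Notation "\csum_ ( m <= i < n | P ) F" := (\big[Cadd/Czero]_(m <= i < n | P%B) F)
  (at level 41, F at level 41, i, m, n at level 50,
   format "'[' \csum_ ( m  <=  i  <  n  |  P ) '/  '  F ']'").

Lemma csum_recr (F : nat -> Cplx) (n : nat) :
  \csum_(1 <= i < n.+2) F i = Cadd (\csum_(1 <= i < n.+1) F i) (F n.+1).
Proof. by rewrite big_nat_recr. Qed.

Lemma csum_distrl (a b : nat) (P : pred nat) (F : nat -> Cplx) (c : Cplx) :
  \csum_(a <= i < b | P i) (Cmul c (F i)) = Cmul c (\csum_(a <= i < b | P i) F i).
Proof. by rewrite big_distrr. Qed.

Lemma csum_opp (a b : nat) (F : nat -> Cplx) :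
  \csum_(a <= i < b) (Copp (F i)) = Copp (\csum_(a <= i < b) F i).
Proof.
have H1 : {morph Copp : x y / Cadd x y} by move=> x y; ring.
have H0 : Copp Czero = Czero by ring.
by rewrite (big_morph Copp H1 H0).
Qed.

Lemma csum_add (a b : nat) (F G : nat -> Cplx) :
  \csum_(a <= i < b) (Cadd (F i) (G i)) =
  Cadd (\csum_(a <= i < b) F i) (\csum_(a <= i < b) G i).
Proof. by rewrite big_split. Qed.

Lemma csum_sub (a b : nat) (F G : nat -> Cplx) :
  \csum_(a <= i < b) (Csub (F i) (G i)) =
  Csub (\csum_(a <= i < b) F i) (\csum_(a <= i < b) G i).
Proof.
have -> : Csub (\csum_(a <= i < b) F i) (\csum_(a <= i < b) G i) =
  Cadd (\csum_(a <= i < b) F i) (Copp (\csum_(a <= i < b) G i)) by ring.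
by rewrite -csum_opp -csum_add; apply: eq_bigr => i _; ring.
Qed.

Lemma csum_cat (a b c : nat) (F : nat -> Cplx) : (a <= b <= c)%N ->
  \csum_(a <= i < c) F i = Cadd (\csum_(a <= i < b) F i) (\csum_(b <= i < c) F i).
Proof. by case/andP=> ab bc; rewrite (big_cat_nat ab bc). Qed.

Lemma csum_RtoC (a b : nat) (P : pred nat) (F : nat -> R) :
  \csum_(a <= i < b | P i) RtoC (F i) = RtoC (\sum_(a <= i < b | P i) F i).
Proof.
have H1 : {morph RtoC : x y / x + y >-> Cadd x y}.
  by move=> x y; apply: Cplx_eq => /=; ring.
by rewrite (big_morph RtoC H1 (erefl _)).
Qed.

Lemma Csum_iota (N : nat) (F : nat -> Cplx) :
  Csum (List.seq 1 N) F = \csum_(1 <= n < N.+1) F n.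
Proof.
rewrite /index_iota subn1 /=; elim: N 1%N => [|N IH] a /=; first by rewrite big_nil.
by rewrite big_cons IH.
Qed.

Lemma Csum_filter (a m : nat) (P : pred nat) (F : nat -> Cplx) :
  Csum (List.filter P (List.seq a m)) F = \csum_(a <= n < a + m | P n) F n.
Proof.
rewrite /index_iota addKn; elim: m a => [|m IH] a /=; first by rewrite big_nil.
by rewrite big_cons; case: (P a); rewrite /= IH.
Qed.

(** The sum norm replaces the modulus: it is subadditive and submultiplicative without square roots,
    and the estimates tolerate constant factors. *)
Definition cnorm (z : Cplx) : R := Rabs (fst z) + Rabs (snd z).

Lemma cnorm_ge0 (z : Cplx) : 0 <= cnorm z.
Proof. by have := Rabs_pos (fst z); have := Rabs_pos (snd z); rewrite /cnorm; lra. Qed.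

Lemma cnorm0 : cnorm Czero = 0.
Proof. by rewrite /cnorm /= Rabs_R0; lra. Qed.

Lemma cnorm_add (x y : Cplx) : cnorm (Cadd x y) <= cnorm x + cnorm y.
Proof.
have := Rabs_triang (fst x) (fst y); have := Rabs_triang (snd x) (snd y).
by rewrite /cnorm /=; lra.
Qed.

Lemma cnorm_opp (x : Cplx) : cnorm (Copp x) = cnorm x.
Proof. by rewrite /cnorm /= !Rabs_Ropp. Qed.

Lemma cnorm_sub (x y : Cplx) : cnorm (Csub x y) <= cnorm x + cnorm y.
Proof.
have -> : Csub x y = Cadd x (Copp y) by ring.
by have := cnorm_add x (Copp y); rewrite cnorm_opp.
Qed.

Lemma cnorm_mul (x y : Cplx) : cnorm (Cmul x y) <= cnorm x * cnorm y.
Proof.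
rewrite /cnorm /=; have := Rabs_triang (fst x * fst y) (- (snd x * snd y)).
have := Rabs_triang (fst x * snd y) (snd x * fst y).
by rewrite Rabs_Ropp !Rabs_mult /Rminus; lra.
Qed.

Lemma cnorm_RtoC (x : R) : cnorm (RtoC x) = Rabs x.
Proof. by rewrite /cnorm /= Rabs_R0; lra. Qed.

Lemma cnorm_sum_le (a b : nat) (F : nat -> Cplx) (G : nat -> R) :
  (forall i, (a <= i < b)%N -> cnorm (F i) <= G i) ->
  cnorm (\csum_(a <= i < b) F i) <= \sum_(a <= i < b) G i.
Proof.
move=> H; rewrite !big_nat; elim/big_ind2: _ => [|x2 x1 y2 y1 H1 H2|//].
  by rewrite cnorm0; lra.
by have := cnorm_add x1 y1; lra.
Qed.

(** * Little-o calculus *)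

Definition littleo (g : nat -> R) (u : nat -> Cplx) : Prop :=
  forall e, 0 < e -> exists N0, forall N, (N0 <= N)%N -> cnorm (u N) <= e * g N.

Lemma littleo_ext (g : nat -> R) (u v : nat -> Cplx) :
  (forall N, (0 < N)%N -> u N = v N) -> littleo g u -> littleo g v.
Proof.
move=> H Hu e e0; have [N0 HN0] := Hu e e0; exists N0.+1 => N HN.
by rewrite -H; [apply: HN0 | ]; lia.
Qed.

Lemma littleo_add (g : nat -> R) (u v : nat -> Cplx) :
  littleo g u -> littleo g v -> littleo g (fun N => Cadd (u N) (v N)).
Proof.
move=> Hu Hv e e0; have [N1 H1] := Hu (e / 2) ltac:(lra); have [N2 H2] := Hv (e / 2) ltac:(lra).
exists (N1 + N2)%N => N HN; have := H1 N ltac:(lia); have := H2 N ltac:(lia).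
by have := cnorm_add (u N) (v N); lra.
Qed.

Lemma littleo_mul (g h : nat -> R) (c u : nat -> Cplx) (B : R) : 0 <= B ->
  (forall N, (0 < N)%N -> 0 <= h N /\ cnorm (c N) * g N <= B * h N) ->
  littleo g u -> littleo h (fun N => Cmul (c N) (u N)).
Proof.
move=> B0 Hc Hu e e0.
have eB : 0 < e / (B + 1) by apply: Rdiv_lt_0_compat; lra.
have [N0 HN0] := Hu (e / (B + 1)) eB.
exists N0.+1 => N HN; have [h0 Hg] := Hc N ltac:(lia).
apply: Rle_trans (cnorm_mul _ _) _; have c0 := cnorm_ge0 (c N).
apply: (@Rle_trans _ (cnorm (c N) * (e / (B + 1) * g N))).
  by apply: Rmult_le_compat_l => //; apply: HN0; lia.
have -> : e * h N = e / (B + 1) * (B * h N + h N) by field; lra.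
have -> : cnorm (c N) * (e / (B + 1) * g N) = e / (B + 1) * (cnorm (c N) * g N) by ring.
by apply: Rmult_le_compat_l; lra.
Qed.

Lemma littleo_const_mul (g : nat -> R) (c : Cplx) (u : nat -> Cplx) :
  (forall N, (0 < N)%N -> 0 <= g N) ->
  littleo g u -> littleo g (fun N => Cmul c (u N)).
Proof.
move=> g0; apply: (littleo_mul (cnorm_ge0 c)) => N N0; split; [exact: g0 | lra].
Qed.

Lemma littleo_sub (g : nat -> R) (u v : nat -> Cplx) :
  littleo g u -> littleo g v -> littleo g (fun N => Csub (u N) (v N)).
Proof.
move=> Hu Hv; have Hv' : littleo g (fun N => Copp (v N)).
  move=> e e0; have [N0 HN0] := Hv e e0; exists N0 => N HN.
  by rewrite cnorm_opp; apply: HN0.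
apply: littleo_ext (littleo_add Hu Hv') => N _; ring.
Qed.

Lemma littleo_sum (g : nat -> R) (u : nat -> nat -> Cplx) (m : nat) :
  (forall N, (0 < N)%N -> 0 <= g N) ->
  (forall j, (0 < j <= m)%N -> littleo g (u j)) ->
  littleo g (fun N => \csum_(1 <= j < m.+1) u j N).
Proof.
move=> g0; elim: m => [|m IH] Hu.
  move=> e e0; exists 1%N => N HN; rewrite big_geq // cnorm0.
  by apply: Rmult_le_pos; [lra | apply: g0].
apply: (@littleo_ext _ (fun N => Cadd (\csum_(1 <= j < m.+1) u j N) (u m.+1 N))).
  by move=> N _; rewrite csum_recr.
by apply: littleo_add; [apply: IH => j Hj | ]; apply: Hu; lia.
Qed.

Lemma leq_divn_of_mul (k n N : nat) : (0 < k)%N -> (k * n <= N)%N -> (n <= N %/ k)%N.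
Proof. by move=> k0 H; rewrite leq_divRL // mulnC. Qed.

Lemma littleo1_div (u : nat -> Cplx) (k : nat) : (0 < k)%N ->
  littleo (fun=> 1) u -> littleo (fun=> 1) (fun N => u (N %/ k)%N).
Proof.
move=> k0 Hu e e0; have [N0 HN0] := Hu e e0; exists (k * N0)%N => N HN.
exact/HN0/leq_divn_of_mul.
Qed.

(** Lets the cut-off [K] stay fixed while [N] grows: an error [O(1/K)], uniform in [N], is removed
    at the end by taking [K] large. *)
Lemma littleo_squeeze (g : nat -> R) (u : nat -> Cplx) (B : R) : 0 <= B ->
  (forall N, (0 < N)%N -> 0 <= g N) ->
  (forall K, (0 < K)%N -> exists v, littleo g v /\
     forall N, (0 < N)%N -> cnorm (Csub (u N) (v N)) <= B / INR K * g N) ->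
  littleo g u.
Proof.
move=> B0 g0 H e e0; have [K HK] := INR_unbounded (2 * B / e).
have [v [Hv Huv]] := H K.+1 isT.
have [N0 HN0] := Hv (e / 2) ltac:(lra).
exists N0.+1 => N HN; have := HN0 N ltac:(lia); have := Huv N ltac:(lia).
have -> : u N = Cadd (Csub (u N) (v N)) (v N) by ring.
have := cnorm_add (Csub (u N) (v N)) (v N).
have -> : Csub (Cadd (Csub (u N) (v N)) (v N)) (v N) = Csub (u N) (v N) by ring.
suff : B / INR K.+1 * g N <= e / 2 * g N by lra.
apply: Rmult_le_compat_r; first by apply: g0; lia.
have HK1 := INR_pos (ltn0Sn K); apply: (Rmult_le_reg_r (INR K.+1)) => //.
have -> : B / INR K.+1 * INR K.+1 = e / 2 * (2 * B / e) by field; lra.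
by apply: Rmult_le_compat_l; [lra | rewrite S_INR; lra].
Qed.

Lemma littleo1_cv (u : nat -> Cplx) (L : Cplx) :
  littleo (fun=> 1) (fun N => Csub (u N) L) -> Cseq_cv u L.
Proof.
move=> H; split=> e e0; have [N0 HN0] := H (e / 2) ltac:(lra); exists N0 => n Hn;
  have := HN0 n ltac:(lia); rewrite /Rdist /cnorm /=.
  by have := Rabs_pos (snd (u n) - snd L); lra.
by have := Rabs_pos (fst (u n) - fst L); lra.
Qed.

(** For [n > N %/ K] the inner index satisfies [j <= N %/ n <= K]; after the exchange the number of
    outer terms no longer grows with [N]. *)
Lemma sum_swap_floor (f w : nat -> Cplx) (a K N : nat) : (0 < K)%N -> a = (N %/ K)%N ->
  \csum_(a.+1 <= n < N.+1) (Cmul (f n) (\csum_(1 <= j < (N %/ n).+1) w j)) =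
  \csum_(1 <= j < K.+1) (Cmul (w j) (\csum_(a.+1 <= n < (N %/ j).+1) f n)).
Proof.
move=> K0 Ea.
transitivity (\csum_(a.+1 <= n < N.+1) \csum_(1 <= j < K.+1 | (j * n <= N)%N)
                 (Cmul (f n) (w j))).
  apply: eq_big_nat => n Hn; rewrite -csum_distrl.
  have n0 : (0 < n)%N by lia.
  have HK : (N %/ n <= K)%N.
    rewrite -ltnS ltn_divLR //; have := ltn_ceil N K0; rewrite -Ea => H.
    by apply: leq_trans H _; rewrite mulnC; apply: leq_mul; lia.
  rewrite [LHS](big_nat_widen _ _ K.+1) //.
  rewrite [LHS]big_nat_cond [RHS]big_nat_cond; apply: eq_bigl => j.
  by rewrite !ltnS leq_divRL.
rewrite (exchange_big_dep xpredT) //=; apply: eq_big_nat => j Hj.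
rewrite -csum_distrl [RHS](big_nat_widen _ _ N.+1); last by rewrite ltnS leq_div.
rewrite [LHS]big_nat_cond [RHS]big_nat_cond; apply: eq_big => [n|n _]; last by ring.
by rewrite !ltnS leq_divRL; [rewrite mulnC | lia].
Qed.

(* Axer's argument: for [n > N/K] only the first [K] values of the floor
   function [N %/ n] occur. *)
Lemma axer (g : nat -> R) (f w : nat -> Cplx) (K : nat) : (0 < K)%N ->
  (forall N, (0 < N)%N -> 0 <= g N) ->
  (forall k, (0 < k)%N -> littleo g (fun N => Csub (\csum_(1 <= n < N.+1) f n)
                                        (\csum_(1 <= n < (N %/ k).+1) f n))) ->
  littleo g (fun N => \csum_((N %/ K).+1 <= n < N.+1)
                Cmul (f n) (\csum_(1 <= j < (N %/ n).+1) w j)).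
Proof.
move=> K0 g0 Hf.
pose S N := \csum_(1 <= n < N.+1) f n.
apply: (@littleo_ext _ (fun N => \csum_(1 <= j < K.+1)
   Cmul (w j) (Csub (Csub (S N) (S (N %/ K)%N)) (Csub (S N) (S (N %/ j)%N))))).
  move=> N N0; rewrite (@sum_swap_floor f w (N %/ K) K N) //.
  apply: eq_big_nat => j Hj; congr Cmul.
  have -> : S (N %/ j)%N = Cadd (S (N %/ K)%N) (\csum_((N %/ K).+1 <= n < (N %/ j).+1) f n).
    by apply: csum_cat; rewrite /= ltnS leq_div2l //; lia.
  ring.
apply: littleo_sum => // j Hj; apply: littleo_const_mul => //.
by apply: littleo_sub; apply: Hf; lia.
Qed.

(** * Powers on the line [Re s = 1] *)

Lemma Cpow_mulx (x y : R) (z : Cplx) : 0 < x -> 0 < y ->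
  Cpow (x * y) z = Cmul (Cpow x z) (Cpow y z).
Proof.
move=> x0 y0; rewrite /Cpow ln_mult // !Rmult_plus_distr_l exp_plus cos_plus sin_plus.
by apply: Cplx_eq => /=; ring.
Qed.

Lemma Cpow_addz (x : R) (z w : Cplx) : Cpow x (Cadd z w) = Cmul (Cpow x z) (Cpow x w).
Proof.
rewrite /Cpow /= !Rmult_plus_distr_r exp_plus cos_plus sin_plus.
by apply: Cplx_eq => /=; ring.
Qed.

Lemma Cpow_0 (x : R) : Cpow x Czero = Cone.
Proof. by rewrite /Cpow /= !Rmult_0_l exp_0 cos_0 sin_0 Rmult_1_l Rmult_0_r. Qed.

Lemma Cpow_1 (x : R) : 0 < x -> Cpow x Cone = RtoC x.
Proof.
by move=> x0; rewrite /Cpow /= Rmult_0_l cos_0 sin_0 Rmult_1_l exp_ln // Rmult_1_r Rmult_0_r.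
Qed.

Lemma cnorm_Cpow (x : R) (z : Cplx) : cnorm (Cpow x z) <= 2 * exp (fst z * ln x).
Proof.
have E := exp_pos (fst z * ln x); rewrite /cnorm /Cpow /= !Rabs_mult (Rabs_pos_eq (exp _)); last by lra.
have := COS_bound (snd z * ln x); have := SIN_bound (snd z * ln x) => H1 H2.
have : Rabs (sin (snd z * ln x)) <= 1 by apply: Rabs_le; lra.
have : Rabs (cos (snd z * ln x)) <= 1 by apply: Rabs_le; lra.
nra.
Qed.

Definition npow (s : Cplx) (n : nat) : Cplx := Cpow (INR n) (Copp s).

Lemma npow_mul (s : Cplx) (m n : nat) : (0 < m)%N -> (0 < n)%N ->
  npow s (m * n) = Cmul (npow s m) (npow s n).
Proof. by move=> m0 n0; rewrite /npow mult_INR Cpow_mulx //; apply: INR_pos. Qed.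

Lemma npow1 (s : Cplx) : npow s 1 = Cone.
Proof. by rewrite /npow /Cpow /= ln_1 !Rmult_0_r exp_0 cos_0 sin_0 Rmult_1_l Rmult_0_r. Qed.

Lemma exp_oppln (x : R) : 0 < x -> exp (-1 * ln x) = / x.
Proof.
by move=> x0; have -> : -1 * ln x = - ln x by [ring]; rewrite exp_Ropp exp_ln.
Qed.

Lemma cnorm_npow (s : Cplx) (n : nat) : fst s = 1 -> (0 < n)%N ->
  cnorm (npow s n) <= 2 * / INR n.
Proof.
move=> Hs n0; have := cnorm_Cpow (INR n) (Copp s); rewrite -/(npow s n) /= Hs.
by rewrite exp_oppln //; apply: INR_pos.
Qed.

(* Real and imaginary parts of [x^(-1+ib)] and of its primitive [x^(ib)/(ib)],
   for [th = 0] and [th = - PI / 2] respectively. *)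
Definition osc (b th x : R) : R := exp (-1 * ln x) * cos (b * ln x + th).
Definition oscint (b th x : R) : R := sin (b * ln x + th) * / b.

Lemma derivable_phase (b th x : R) : 0 < x ->
  derivable_pt_lim (fun x => b * ln x + th) x (b * / x).
Proof.
move=> x0; have -> : b * / x = b * / x + 0 by ring.
apply: (derivable_pt_lim_plus (fun x => b * ln x) (fun=> th)).
  exact/derivable_pt_lim_scal/derivable_pt_lim_ln.
exact: derivable_pt_lim_const.
Qed.

Lemma derivable_osc (b th x : R) : 0 < x ->
  derivable_pt_lim (osc b th) x
    (- / (x * x) * (cos (b * ln x + th) + b * sin (b * ln x + th))).
Proof.
move=> x0.
(* The added 0 makes this the case [b = -1], [th = 0] of [derivable_phase]. *)
have H1 : derivable_pt_lim (fun x => exp (-1 * ln x + 0)) x (exp (-1 * ln x + 0) * (-1 * / x)).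
  apply: (derivable_pt_lim_comp (fun x => -1 * ln x + 0) exp); first exact: derivable_phase.
  exact: derivable_pt_lim_exp.
have H2 : derivable_pt_lim (fun x => cos (b * ln x + th)) x (- sin (b * ln x + th) * (b * / x)).
  apply: (derivable_pt_lim_comp (fun x => b * ln x + th) cos); first exact: derivable_phase.
  exact: derivable_pt_lim_cos.
have := derivable_pt_lim_mult _ _ _ _ _ H1 H2.
rewrite Rplus_0_r exp_oppln //.
have -> : / x * (-1 * / x) * cos (b * ln x + th) + / x * (- sin (b * ln x + th) * (b * / x))
  = - / (x * x) * (cos (b * ln x + th) + b * sin (b * ln x + th)) by field; lra.
apply: derivable_pt_lim_ext => y; by rewrite /mult_fct /osc Rplus_0_r.
Qed.

Lemma derivable_oscint (b th x : R) : b <> 0 -> 0 < x ->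
  derivable_pt_lim (oscint b th) x (osc b th x).
Proof.
move=> b0 x0.
have H1 : derivable_pt_lim (fun x => sin (b * ln x + th)) x (cos (b * ln x + th) * (b * / x)).
  apply: (derivable_pt_lim_comp (fun x => b * ln x + th) sin); first exact: derivable_phase.
  exact: derivable_pt_lim_sin.
have := derivable_pt_lim_scal _ (/ b) _ _ H1.
have -> : / b * (cos (b * ln x + th) * (b * / x)) = osc b th x.
  by rewrite /osc exp_oppln //; field; lra.
apply: derivable_pt_lim_ext => y; by rewrite /mult_real_fct /oscint Rmult_comm.
Qed.

Lemma osc_bound (b th x : R) : 0 < x -> Rabs (osc b th x) <= / x.
Proof.
move=> x0; have := Rinv_0_lt_compat x x0 => H.
rewrite /osc exp_oppln // Rabs_mult (Rabs_pos_eq (/ x)); last by lra.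
have H1 : Rabs (cos (b * ln x + th)) <= 1 by apply/Rabs_le/COS_bound.
nra.
Qed.

Lemma osc_lipschitz (b th x y : R) : 0 < x -> x <= y ->
  Rabs (osc b th y - osc b th x) <= (1 + Rabs b) * / (x * x) * (y - x).
Proof.
move=> x0 [xy|->]; last by rewrite !Rminus_diag Rabs_R0; lra.
have [|c [-> [Hc1 Hc2]]] := MVT_cor2 (osc b th)
  (fun x => - / (x * x) * (cos (b * ln x + th) + b * sin (b * ln x + th))) x y xy.
  by move=> c Hc; apply: derivable_osc; lra.
rewrite Rabs_mult (Rabs_pos_eq (y - x)); last by lra.
apply: Rmult_le_compat_r; first by lra.
rewrite Rabs_mult Rabs_Ropp (Rabs_pos_eq (/ _)); last by apply/Rlt_le/Rinv_0_lt_compat; nra.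
rewrite Rmult_comm; apply: Rmult_le_compat; try exact: Rabs_pos.
- by apply/Rlt_le/Rinv_0_lt_compat; nra.
- apply: Rle_trans (Rabs_triang _ _) _; rewrite Rabs_mult.
  have H1 : Rabs (cos (b * ln c + th)) <= 1 by apply/Rabs_le/COS_bound.
  have H2 : Rabs (sin (b * ln c + th)) <= 1 by apply/Rabs_le/SIN_bound.
  by have := Rabs_pos b; nra.
- by apply: Rinv_le_contravar; nra.
Qed.

Lemma oscint_lipschitz (b th x y : R) : b <> 0 -> 0 < x -> x <= y ->
  Rabs (oscint b th y - oscint b th x) <= / x * (y - x).
Proof.
move=> b0 x0 [xy|->]; last by rewrite !Rminus_diag Rabs_R0; lra.
have [|c [-> [Hc1 Hc2]]] := MVT_cor2 (oscint b th) (osc b th) x y xy.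
  by move=> c Hc; apply: derivable_oscint; lra.
rewrite Rabs_mult (Rabs_pos_eq (y - x)); last by lra.
apply: Rmult_le_compat_r; first by lra.
apply: (@Rle_trans _ (/ c)); [apply: osc_bound; lra | apply: Rinv_le_contravar; lra].
Qed.

Lemma cos_sub_PI2 (x : R) : cos (x + - (PI / 2)) = sin x.
Proof. by rewrite cos_plus cos_neg sin_neg cos_PI2 sin_PI2; ring. Qed.

Lemma sin_sub_PI2 (x : R) : sin (x + - (PI / 2)) = - cos x.
Proof. by rewrite sin_plus cos_neg sin_neg cos_PI2 sin_PI2; ring. Qed.

Lemma Cpow_osc (s : Cplx) (x : R) : fst s = 1 ->
  Cpow x (Copp s) = (osc (- snd s) 0 x, osc (- snd s) (- (PI / 2)) x).
Proof.
by move=> Hs; rewrite /osc Rplus_0_r cos_sub_PI2 /Cpow /= Hs.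
Qed.

Lemma cnorm_npow_step (s : Cplx) (n : nat) : fst s = 1 -> (0 < n)%N ->
  cnorm (Csub (npow s n) (npow s n.+1)) <= 2 * (1 + Rabs (snd s)) * / (INR n * INR n).
Proof.
move=> Hs n0; rewrite /npow !Cpow_osc //.
have H := INR_pos n0; have Hn : INR n <= INR n.+1 by apply: le_INR; lia.
have E : INR n.+1 - INR n = 1 by rewrite S_INR; ring.
move: (INR n.+1) Hn E => m Hn E; rewrite /cnorm /=.
have := @osc_lipschitz (- snd s) 0 _ _ H Hn.
have := @osc_lipschitz (- snd s) (- (PI / 2)) _ _ H Hn.
rewrite E Rabs_Ropp (Rabs_minus_sym (osc _ 0 (INR n))) (Rabs_minus_sym (osc _ (- (PI / 2)) (INR n))).
lra.
Qed.

Definition musum (s : Cplx) (N : nat) : Cplx :=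
  \csum_(1 <= n < N.+1) Cmul (RtoC (mu n)) (npow s n).

Lemma musum_abel (s : Cplx) (N : nat) : (0 < N)%N ->
  musum s N = Cadd (Cmul (RtoC (Mert N)) (npow s N))
    (\csum_(1 <= n < N) Cmul (RtoC (Mert n)) (Csub (npow s n) (npow s n.+1))).
Proof.
elim: N => // -[_ _|N IH _].
  rewrite /musum big_nat1 big_geq // /Mert big_nat1; ring.
rewrite /musum csum_recr -/(musum s N.+1) IH // [in RHS]csum_recr -Mert_step.
have -> : RtoC (Mert N.+2 - Mert N.+1) = Csub (RtoC (Mert N.+2)) (RtoC (Mert N.+1)).
  by apply: Cplx_eq => /=; ring.
ring.
Qed.

(** Partial summation leaves terms [o(1/n)]; over the block from [N %/ k] to [N], whose endpoints
    have bounded ratio, they add up to [o(1)]. *)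
Lemma musum_block (s : Cplx) (k : nat) : fst s = 1 -> (0 < k)%N ->
  littleo (fun=> 1) (fun N => Csub (musum s N) (musum s (N %/ k)%N)).
Proof.
move=> Hs k0 e e0.
pose B := 1 + Rabs (snd s); have B1 : 1 <= B by have := Rabs_pos (snd s); rewrite /B; lra.
have Hk := INR_ge1 k0.
(* In units of [e / D]: two boundary terms of at most 2 each, and at most [2 * k * a] middle terms
   of at most [2 * B / a] each. *)
pose D := 4 + 4 * B * INR k; have D0 : 0 < D by rewrite /D; nra.
have [N0 HN0] := @mertens_o (e / D) ltac:(apply: Rdiv_lt_0_compat; lra).
have eD : 0 < e / D by apply: Rdiv_lt_0_compat; lra.
exists (k * N0.+1)%N => N HN; rewrite Rmult_1_r.
pose a := (N %/ k)%N; have Ha : (N0.+1 <= a)%N by apply: leq_divn_of_mul.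
have aN : (a <= N)%N by apply: leq_div.
have a0 : (0 < a)%N by lia.
have N1 : (0 < N)%N by lia.
have HM n : (a <= n)%N -> cnorm (RtoC (Mert n)) <= e / D * INR n.
  by move=> H; rewrite cnorm_RtoC; apply: HN0; lia.
have Hend n : (a <= n)%N -> cnorm (Cmul (RtoC (Mert n)) (npow s n)) <= 2 * (e / D).
  move=> H; have n0 : (0 < n)%N by lia.
  apply: Rle_trans (cnorm_mul _ _) _.
  have -> : 2 * (e / D) = e / D * INR n * (2 * / INR n).
    by have := INR_pos n0 => H1; field; lra.
  by apply: Rmult_le_compat; [exact: cnorm_ge0 | exact: cnorm_ge0 | exact: HM | exact: cnorm_npow].
have -> : Csub (musum s N) (musum s a) =
  Cadd (Csub (Cmul (RtoC (Mert N)) (npow s N)) (Cmul (RtoC (Mert a)) (npow s a)))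
    (\csum_(a <= n < N) Cmul (RtoC (Mert n)) (Csub (npow s n) (npow s n.+1))).
  rewrite !musum_abel // (@csum_cat 1 a N); [ring | lia].
have Hmid : cnorm (\csum_(a <= n < N)
     Cmul (RtoC (Mert n)) (Csub (npow s n) (npow s n.+1))) <= e / D * (4 * B * INR k).
  apply: (@Rle_trans _ (\sum_(a <= n < N) (e / D * (2 * B) * / INR a))).
    apply: cnorm_sum_le => n Hn; have n0 : (0 < n)%N by lia.
    have Hn0 := INR_pos n0.
    apply: Rle_trans (cnorm_mul _ _) _.
    apply: (@Rle_trans _ (e / D * INR n * (2 * B * / (INR n * INR n)))).
      apply: Rmult_le_compat; [exact: cnorm_ge0 | exact: cnorm_ge0 | apply: HM; lia | ].
      exact: cnorm_npow_step.
    have -> : e / D * INR n * (2 * B * / (INR n * INR n)) = e / D * (2 * B) * / INR n.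
      by field; lra.
    apply: Rmult_le_compat_l; first by nra.
    by apply: Rinv_le_contravar; [apply: INR_pos | apply: le_INR; lia].
  have Ha0 := INR_pos a0.
  rewrite big_const_nat.
  have -> : iter (N - a) (Rplus (e / D * (2 * B) * / INR a)) 0 =
            INR (N - a) * (e / D * (2 * B) * / INR a).
    by elim: (N - a)%N => [|m IH]; [rewrite /=; lra | rewrite iterS IH S_INR; ring].
  have Hq : INR (N - a) <= 2 * INR k * INR a.
    have -> : 2 = INR 2 by []; rewrite -!mult_INR; apply: le_INR.
    have := ltn_ceil N k0; rewrite -/a => H.
    by have : (k <= k * a)%N by [rewrite leq_pmulr]; lia.
  have -> : e / D * (4 * B * INR k) = 2 * INR k * INR a * (e / D * (2 * B) * / INR a).
    by field; lra.
  apply: Rmult_le_compat_r => //.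
  by apply: Rmult_le_pos; [nra | exact/Rlt_le/Rinv_0_lt_compat].
apply: Rle_trans (cnorm_add _ _) _.
have := cnorm_sub (Cmul (RtoC (Mert N)) (npow s N)) (Cmul (RtoC (Mert a)) (npow s a)).
have := Hend N aN; have := Hend a (leqnn _) => H1 H2 H3.
have -> : e = e / D * (4 + 4 * B * INR k) by rewrite -/D; field; lra.
lra.
Qed.

(** * Zeta on the line [Re s = 1] *)

Lemma cv_inv (A : R) : 0 <= A -> Un_cv (fun k => A * / INR k) 0.
Proof.
move=> A0 e e0; have [N0 HN0] := INR_unbounded (A / e).
exists N0.+1 => n Hn; have n0 : (0 < n)%N by lia.
have H := INR_pos n0; rewrite /Rdist Rminus_0_r Rabs_pos_eq; last first.
  by apply: Rmult_le_pos => //; exact/Rlt_le/Rinv_0_lt_compat.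
apply: (Rmult_lt_reg_r (INR n)) => //; rewrite Rmult_assoc Rinv_l; last by lra.
have Hn1 : INR N0 <= INR n by apply: le_INR; lia.
have -> : A * 1 = e * (A / e) by field; lra.
by apply: Rmult_lt_compat_l; lra.
Qed.

(** By the mean value theorem, adding [osc] at [k + 1] and subtracting the increment of [oscint]
    leaves a difference of two values of [osc] in [[k, k + 1]], which is [O(1/k^2)]. *)
Lemma sum_osc (b th : R) : b <> 0 -> exists c, forall k, (0 < k)%N ->
  Rabs (\sum_(1 <= j < k.+1) osc b th (INR j) - oscint b th (INR k) - c) <=
  2 * (1 + Rabs b) * / INR k.
Proof.
move=> b0; have Hb := Rabs_pos b.
pose E k := \sum_(1 <= j < k.+1) osc b th (INR j) - oscint b th (INR k).
have [||c [_ Hc]] := @cv_of_telescope E (fun k => 2 * (1 + Rabs b) * / INR k)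
  (@cv_inv (2 * (1 + Rabs b)) ltac:(lra)); last by exists c.
  by move=> k k0; apply: Rmult_le_pos; [lra | exact/Rlt_le/Rinv_0_lt_compat/INR_pos].
move=> k k0; have Hk := INR_pos k0; have Hk1 := INR_ge1 k0.
have HE : INR k.+1 = INR k + 1 by rewrite S_INR.
have [||x [Hx [Hx1 Hx2]]] := MVT_cor2 (oscint b th) (osc b th) (INR k) (INR k.+1).
- by lra.
- by move=> x Hx; apply: derivable_oscint; lra.
have -> : E k.+1 - E k = osc b th (INR k.+1) - osc b th x.
  by rewrite /E sum_recr; rewrite HE in Hx *; lra.
apply: Rle_trans (@osc_lipschitz b th x (INR k.+1) ltac:(lra) ltac:(lra)) _.
have H1 : / (x * x) <= / (INR k * INR k) by apply: Rinv_le_contravar; nra.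
have H2 : 0 < / (x * x) by apply: Rinv_0_lt_compat; nra.
have H3 : / (INR k * INR k) <= 2 * (/ INR k - / INR k.+1).
  have -> : 2 * (/ INR k - / INR k.+1) = / (INR k * INR k) * (2 * INR k / (INR k + 1)).
    by rewrite HE; field; lra.
  rewrite -[X in X <= _]Rmult_1_r; apply: Rmult_le_compat_l.
    by apply/Rlt_le/Rinv_0_lt_compat; nra.
  by apply: (Rmult_le_reg_r (INR k + 1)); [lra | rewrite /Rdiv Rmult_assoc Rinv_l; lra].
have H4 : / (x * x) * (INR k.+1 - x) <= 2 * (/ INR k - / INR k.+1) by nra.
rewrite Rmult_assoc; have -> : 2 * (1 + Rabs b) * / INR k - 2 * (1 + Rabs b) * / INR k.+1 =
  (1 + Rabs b) * (2 * (/ INR k - / INR k.+1)) by ring.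
by apply: Rmult_le_compat_l; lra.
Qed.

Definition zsum (s : Cplx) (k : nat) : Cplx := \csum_(1 <= j < k.+1) npow s j.
Definition zmain (s : Cplx) (x : R) : Cplx := Cdiv (Cpow x (Csub Cone s)) (Csub Cone s).

Lemma zmain_osc (s : Cplx) (x : R) : fst s = 1 -> snd s <> 0 ->
  zmain s x = (oscint (- snd s) 0 x, oscint (- snd s) (- (PI / 2)) x).
Proof.
case: s => r t /= -> t0.
rewrite /zmain /Cdiv /Cpow /oscint Rplus_0_r sin_sub_PI2 /=.
have -> : 0 - t = - t by ring.
have -> : (1 - 1) * ln x = 0 by ring.
rewrite exp_0; apply: Cplx_eq => /=; field; lra.
Qed.

(** [z] is [zeta(s)] in the sense of [is_zeta]. The rate [A / k], beyond mere convergence, makes the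
    range [n <= N/K] negligible in [musum_zeta]. *)
Lemma zsum_zmain (s : Cplx) : fst s = 1 -> snd s <> 0 ->
  exists (z : Cplx) (A : R), 0 <= A /\ forall k, (0 < k)%N ->
    cnorm (Csub (Csub (zsum s k) (zmain s (INR k))) z) <= A * / INR k.
Proof.
move=> Hs t0; have Hb : - snd s <> 0 by lra.
have [x Hx] := sum_osc 0 Hb; have [y Hy] := sum_osc (- (PI / 2)) Hb.
exists (x, y), (4 * (1 + Rabs (- snd s))); split; first by have := Rabs_pos (- snd s); lra.
move=> k k0; have := Hx k k0; have := Hy k k0.
have -> : zsum s k = (\sum_(1 <= j < k.+1) osc (- snd s) 0 (INR j),
                     \sum_(1 <= j < k.+1) osc (- snd s) (- (PI / 2)) (INR j)).
  rewrite /zsum; elim: (k) => [|m IH]; first by rewrite !big_geq.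
  by rewrite csum_recr IH /npow Cpow_osc // !sum_recr.
by rewrite zmain_osc // /cnorm /=; lra.
Qed.

Lemma zmain_lipschitz (s : Cplx) (x y : R) : fst s = 1 -> snd s <> 0 ->
  0 < x -> x <= y -> cnorm (Csub (zmain s y) (zmain s x)) <= 2 * (/ x * (y - x)).
Proof.
move=> Hs t0 x0 xy; have Hb : - snd s <> 0 by lra.
rewrite !zmain_osc // /cnorm /=.
have := oscint_lipschitz 0 Hb x0 xy; have := oscint_lipschitz (- (PI / 2)) Hb x0 xy; lra.
Qed.

Lemma cnorm_zmain (s : Cplx) (x : R) : fst s = 1 ->
  cnorm (zmain s x) <= 2 * cnorm (Cinv (Csub Cone s)).
Proof.
move=> Hs; apply: Rle_trans (cnorm_mul _ _) _.
apply: Rmult_le_compat_r; first exact: cnorm_ge0.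
apply: Rle_trans (cnorm_Cpow _ _) _; rewrite /= Hs.
by have -> : (1 - 1) * ln x = 0 by [ring]; rewrite exp_0; lra.
Qed.

(** This is [n^(-s) (N/n)^(1-s) = N^(1-s) n^(-1)]: summed against [mu], the correction terms
    assemble into [musum Cone]. *)
Lemma npow_zmain (s : Cplx) (N n : nat) : (0 < n)%N -> (0 < N)%N ->
  Cmul (npow s n) (zmain s (INR N / INR n)) = Cmul (zmain s (INR N)) (npow Cone n).
Proof.
move=> n0 N0; have Hn := INR_pos n0; have HN := INR_pos N0.
have Hq : 0 < INR N / INR n by apply: Rdiv_lt_0_compat.
have E1 : Cpow (INR N) (Csub Cone s) =
          Cmul (Cpow (INR N / INR n) (Csub Cone s)) (Cmul (RtoC (INR n)) (npow s n)).
  have -> : Csub Cone s = Cadd Cone (Copp s) by ring.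
  rewrite -[in RHS](Cpow_1 Hn) /npow -[X in _ = Cmul _ X]Cpow_addz -Cpow_mulx //.
  by congr Cpow; field; lra.
have E2 : Cmul (RtoC (INR n)) (npow Cone n) = Cone.
  rewrite -(Cpow_1 Hn) /npow -Cpow_addz.
  by have -> : Cadd Cone (Copp Cone) = Czero by [ring]; rewrite Cpow_0.
rewrite /zmain /Cdiv E1.
set u := Cpow _ _; set v := Cinv _.
transitivity (Cmul (Cmul (RtoC (INR n)) (npow Cone n)) (Cmul (npow s n) (Cmul u v))).
  by rewrite E2; ring.
ring.
Qed.

Lemma sum_musum_zsum (s : Cplx) (N : nat) : (0 < N)%N ->
  \csum_(1 <= n < N.+1) Cmul (Cmul (RtoC (mu n)) (npow s n)) (zsum s (N %/ n)) = Cone.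
Proof.
move=> N0.
transitivity (\csum_(1 <= d < N.+1) \csum_(1 <= m < (N %/ d).+1)
                Cmul (RtoC (mu d)) (npow s (d * m))).
  apply: eq_big_nat => d Hd; rewrite -csum_distrl; apply: eq_big_nat => m Hm.
  by rewrite npow_mul; [ring | lia | lia].
rewrite -(sum_hyperbola Cadd (fun d m => Cmul (RtoC (mu d)) (npow s (d * m)))).
transitivity (\csum_(1 <= n < N.+1) Cmul (npow s n) (RtoC (unit1 n))).
  apply: eq_big_nat => n Hn; rewrite -sum_mu_divisors; last by lia.
  rewrite -csum_RtoC -csum_distrl; apply: eq_bigr => d dn.
  by rewrite mulnC divnK //; ring.
rewrite big_ltn // big1_seq; first by rewrite npow1 /unit1 /=; apply: Cplx_eq => /=; ring.
move=> n; rewrite mem_index_iota => /andP[_ Hn]; rewrite /unit1 ifN; last by apply/eqP; lia.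
by apply: Cplx_eq => /=; ring.
Qed.

Lemma littleo_Mert : littleo INR (fun N => RtoC (Mert N)).
Proof.
move=> e e0; have [N0 HN0] := mertens_o e0; exists N0 => N HN.
by rewrite cnorm_RtoC; apply: HN0.
Qed.

Lemma littleo_INR_div (u : nat -> Cplx) (k : nat) : (0 < k)%N ->
  littleo INR u -> littleo INR (fun N => u (N %/ k)%N).
Proof.
move=> k0 Hu e e0; have [N0 HN0] := Hu e e0; exists (k * N0)%N => N HN.
apply: Rle_trans (HN0 _ (leq_divn_of_mul k0 HN)) _.
by apply: Rmult_le_compat_l; [lra | apply: le_INR; have := leq_div N k; lia].
Qed.

Lemma npow_Cone (n : nat) : (0 < n)%N -> npow Cone n = RtoC (/ INR n).
Proof.
move=> n0; have Hn := INR_pos n0; rewrite /npow /Cpow /= exp_oppln //.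
by rewrite Ropp_0 Rmult_0_l cos_0 sin_0 Rmult_1_r Rmult_0_r.
Qed.

(** [N * musum Cone N - 1] is the sum of [mu(n)] times the fractional part of [N/n]. The range
    [n <= N/K] contributes at most [N/K]; beyond it, [musum_block] treats [N/n] and [axer] with
    weight 1 treats [N %/ n]. *)
Lemma musum_Cone : littleo (fun=> 1) (musum Cone).
Proof.
suff H : littleo INR (fun N => Cmul (RtoC (INR N)) (musum Cone N)).
  apply: (@littleo_ext _ (fun N => Cmul (RtoC (/ INR N)) (Cmul (RtoC (INR N)) (musum Cone N)))).
    move=> N N0; have HN := INR_pos N0.
    by apply: Cplx_eq => /=; field; lra.
  apply: (littleo_mul (B := 1)) H => [|N N0]; first by lra.
  have HN := INR_pos N0; rewrite cnorm_RtoC Rabs_pos_eq.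
    by rewrite Rinv_l; lra.
  exact/Rlt_le/Rinv_0_lt_compat.
apply: (littleo_squeeze (B := 1)); [lra | by move=> *; exact: pos_INR | move=> K K0].
pose f n := RtoC (mu n).
pose T N := \csum_((N %/ K).+1 <= n < N.+1)
              Cmul (f n) (\csum_(1 <= j < (N %/ n).+1) Cone).
exists (fun N => Cadd (Csub (Cmul (RtoC (INR N)) (Csub (musum Cone N) (musum Cone (N %/ K)%N)))
                  (T N)) Cone); split.
  apply: littleo_add; last first.
    move=> e e0; have [N0 HN0] := INR_unbounded (1 / e); exists N0 => N HN.
    have -> : cnorm Cone = e * (1 / e) by rewrite /cnorm /= Rabs_R0 Rabs_R1; field; lra.
    apply: Rmult_le_compat_l; first lra.
    by have : INR N0 <= INR N by [apply: le_INR; lia]; lra.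
  apply: littleo_sub.
    apply: (littleo_mul (B := 1)) (@musum_block Cone K erefl K0) => [|N N0]; first by lra.
    have HN := INR_pos N0.
    by rewrite cnorm_RtoC Rabs_pos_eq; lra.
  apply: axer => //; first by move=> *; exact: pos_INR.
  move=> k k0; rewrite /f.
  apply: (@littleo_ext _ (fun N => Csub (RtoC (Mert N)) (RtoC (Mert (N %/ k)%N)))).
    by move=> N _; rewrite !csum_RtoC.
  apply: littleo_sub; [exact: littleo_Mert | exact: (littleo_INR_div k0 littleo_Mert)].
move=> N N0; have HN := INR_pos N0.
set a := (N %/ K)%N.
have aN : (a <= N)%N by apply: leq_div.
have H1 : Cadd (\csum_(1 <= n < a.+1) Cmul (f n) (RtoC (INR (N %/ n)))) (T N) = Cone.
  have -> : T N = \csum_(a.+1 <= n < N.+1) Cmul (f n) (RtoC (INR (N %/ n))).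
    apply: eq_big_nat => n Hn; congr Cmul.
    by rewrite -sum_1 -csum_RtoC.
  rewrite -csum_cat; last by lia.
  rewrite -[RHS]/(RtoC 1) -(sum_mu_floor N0) -csum_RtoC; apply: eq_bigr => n _.
  by apply: Cplx_eq => /=; ring.
have -> : Csub (Cmul (RtoC (INR N)) (musum Cone N))
    (Cadd (Csub (Cmul (RtoC (INR N)) (Csub (musum Cone N) (musum Cone a))) (T N)) Cone) =
    \csum_(1 <= n < a.+1) Cmul (f n) (RtoC (INR N / INR n - INR (N %/ n))).
  rewrite -[X in Cadd _ X]H1.
  transitivity (Csub (Cmul (RtoC (INR N)) (musum Cone a))
       (\csum_(1 <= n < a.+1) Cmul (f n) (RtoC (INR (N %/ n))))); first by ring.
  rewrite /musum -csum_distrl -csum_sub; apply: eq_big_nat => n Hn.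
  have n0 : (0 < n)%N by lia.
  by rewrite npow_Cone //; apply: Cplx_eq => /=; rewrite /Rdiv; ring.
apply: (@Rle_trans _ (INR a)).
  rewrite -[X in _ <= X]sum_1; apply: cnorm_sum_le => n Hn; have n0 : (0 < n)%N by lia.
  apply: Rle_trans (cnorm_mul _ _) _; rewrite !cnorm_RtoC -[X in _ <= X]Rmult_1_l.
  apply: Rmult_le_compat; try exact: Rabs_pos; first exact: mu_bound.
  by have := INR_divn_le N n0; have := INR_divn_gt N n0 => H2 H3; apply: Rabs_le; lra.
by have := INR_divn_le N K0; rewrite -/a /Rdiv; lra.
Qed.

Lemma musum_zeta (s z : Cplx) (A : R) : fst s = 1 -> snd s <> 0 -> 0 <= A ->
  (forall k, (0 < k)%N ->
    cnorm (Csub (Csub (zsum s k) (zmain s (INR k))) z) <= A * / INR k) ->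
  littleo (fun=> 1) (fun N => Csub Cone (Cmul z (musum s N))).
Proof.
move=> Hs t0 A0 HA.
have H1 : littleo (fun=> 1) (fun N => Cmul (zmain s (INR N)) (musum Cone N)).
  apply: (littleo_mul (B := 2 * cnorm (Cinv (Csub Cone s)))) musum_Cone.
    by have := cnorm_ge0 (Cinv (Csub Cone s)); lra.
  by move=> N _; have := cnorm_zmain (INR N) Hs; lra.
suff H : littleo (fun=> 1) (fun N =>
    Csub (Csub Cone (Cmul z (musum s N))) (Cmul (zmain s (INR N)) (musum Cone N))).
  by apply: littleo_ext (littleo_add H H1) => N _; ring.
(* For [n <= N/K], [f n] is at most [2 / n] and the error [Q n] at most [(A + 2) * 2 * n / N], so
   each term is at most [4 * (A + 2) / N]. *)
apply: (littleo_squeeze (B := 4 * (A + 2))) => [||K K0]; [lra | by move=> *; lra |].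
pose f n := Cmul (RtoC (mu n)) (npow s n).
pose T N := \csum_((N %/ K).+1 <= n < N.+1) Cmul (f n) (zsum s (N %/ n)).
exists (fun N => Csub (Csub (T N) (Cmul z (Csub (musum s N) (musum s (N %/ K)%N))))
   (Cmul (zmain s (INR N)) (Csub (musum Cone N) (musum Cone (N %/ K)%N)))); split.
  apply: littleo_sub; first apply: littleo_sub.
  - apply: axer => // [*|k k0]; [lra | exact: musum_block].
  - by apply: littleo_const_mul; [move=> *; lra | exact: musum_block].
  - apply: (littleo_mul (B := 2 * cnorm (Cinv (Csub Cone s)))) (@musum_block Cone K erefl K0).
      by have := cnorm_ge0 (Cinv (Csub Cone s)); lra.
    by move=> N _; have := cnorm_zmain (INR N) Hs; lra.
move=> N N0; have HN := INR_pos N0; rewrite Rmult_1_r.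
set a := (N %/ K)%N.
have aN : (a <= N)%N by apply: leq_div.
have E1 : Cadd (\csum_(1 <= n < a.+1) Cmul (f n) (zsum s (N %/ n))) (T N) = Cone.
  rewrite -csum_cat; last by lia.
  exact: sum_musum_zsum.
(* [zmain] is taken at the exact quotient so that [npow_zmain] applies; [zmain_lipschitz] pays for
   this, turning [A] into [A + 2]. *)
pose Q n := Csub (Csub (zsum s (N %/ n)) (zmain s (INR N / INR n))) z.
have -> : Csub (Csub (Csub Cone (Cmul z (musum s N))) (Cmul (zmain s (INR N)) (musum Cone N)))
   (Csub (Csub (T N) (Cmul z (Csub (musum s N) (musum s a))))
     (Cmul (zmain s (INR N)) (Csub (musum Cone N) (musum Cone a)))) =
   \csum_(1 <= n < a.+1) Cmul (f n) (Q n).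
  rewrite -[X in Csub X (Cmul z _)]E1.
  transitivity (Csub (Csub (\csum_(1 <= n < a.+1) Cmul (f n) (zsum s (N %/ n)))
     (Cmul (zmain s (INR N)) (musum Cone a))) (Cmul z (musum s a))); first by ring.
  rewrite /musum -!csum_distrl -!csum_sub; apply: eq_big_nat => n Hn.
  have n0 : (0 < n)%N by lia.
  transitivity (Csub (Csub (Cmul (f n) (zsum s (N %/ n)))
    (Cmul (RtoC (mu n)) (Cmul (npow s n) (zmain s (INR N / INR n))))) (Cmul z (f n))).
    by rewrite npow_zmain // /f; ring.
  by rewrite /Q /f; ring.
apply: (@Rle_trans _ (\sum_(1 <= n < a.+1) (4 * (A + 2) * / INR N))).
  apply: cnorm_sum_le => n Hn; have n0 : (0 < n)%N by lia.
  have Hn0 := INR_pos n0.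
  have k0 : (0 < N %/ n)%N by rewrite divn_gt0; lia.
  have Hk := INR_pos k0; have Hk1 := INR_ge1 k0.
  have Hy1 := INR_divn_le N n0; have Hy2 := INR_divn_gt N n0.
  have HQ : cnorm (Q n) <= (A + 2) * / INR (N %/ n).
    have -> : Q n = Csub (Csub (Csub (zsum s (N %/ n)) (zmain s (INR (N %/ n)))) z)
       (Csub (zmain s (INR N / INR n)) (zmain s (INR (N %/ n)))) by rewrite /Q; ring.
    apply: Rle_trans (cnorm_sub _ _) _.
    have := HA _ k0; have := zmain_lipschitz Hs t0 Hk Hy1.
    have : 0 < / INR (N %/ n) by apply: Rinv_0_lt_compat.
    nra.
  have Hf : cnorm (f n) <= 2 * / INR n.
    apply: Rle_trans (cnorm_mul _ _) _; rewrite cnorm_RtoC -[X in _ <= X]Rmult_1_l.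
    apply: Rmult_le_compat; [exact: Rabs_pos | exact: cnorm_ge0 | exact: mu_bound | ].
    exact: cnorm_npow.
  have Hinv : / INR (N %/ n) <= 2 * (INR n * / INR N).
    have -> : 2 * (INR n * / INR N) = / (INR N / INR n / 2) by field; lra.
    by apply: Rinv_le_contravar; [ | lra]; have := Rdiv_lt_0_compat _ _ HN Hn0; lra.
  apply: Rle_trans (cnorm_mul _ _) _.
  apply: (@Rle_trans _ (2 * / INR n * ((A + 2) * (2 * (INR n * / INR N))))).
    apply: Rmult_le_compat; [exact: cnorm_ge0 | exact: cnorm_ge0 | exact: Hf | ].
    by apply: Rle_trans HQ _; apply: Rmult_le_compat_l; lra.
  by apply: Req_le; field; lra.
have -> : \sum_(1 <= n < a.+1) (4 * (A + 2) * / INR N) = 4 * (A + 2) * / INR N * INR a.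
  by rewrite -[INR a]sum_1 -sum_distrl; apply: eq_bigr => n _; ring.
have -> : 4 * (A + 2) / INR K = 4 * (A + 2) * / INR N * (INR N / INR K).
  by have := INR_pos K0 => HK; field; lra.
apply: Rmult_le_compat_l; last exact: INR_divn_le.
by apply: Rmult_le_pos; [lra | exact/Rlt_le/Rinv_0_lt_compat].
Qed.

Lemma CmulV (z : Cplx) : z <> Czero -> Cmul z (Cinv z) = Cone.
Proof.
case: z => x y Hz; have H : 0 < x * x + y * y.
  case: (Rle_lt_dec (x * x + y * y) 0) => // H; case: Hz.
  by apply: Cplx_eq => /=; nra.
by apply: Cplx_eq => /=; field; lra.
Qed.

Lemma Cone_neq0 : Cone <> Czero.
Proof. by case; lra. Qed.

Theorem musum_cv (s : Cplx) : fst s = 1 -> snd s <> 0 ->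
  exists z, is_zeta s z /\ z <> Czero /\
    littleo (fun=> 1) (fun N => Csub (musum s N) (Cinv z)).
Proof.
move=> Hs t0; have [z [A [A0 HA]]] := zsum_zmain Hs t0.
have H := musum_zeta Hs t0 A0 HA.
have z0 : z <> Czero.
  (* For [z = 0] the expression that tends to 0 would be constantly 1. *)
  move=> zE; have [N0 HN0] := H (1 / 2) ltac:(lra).
  have := HN0 N0 (leqnn _); rewrite zE.
  have -> : Csub Cone (Cmul Czero (musum s N0)) = Cone by ring.
  by rewrite /cnorm /= Rabs_R0 Rabs_R1; lra.
exists z; split; last split=> //; last first.
  apply: (@littleo_ext _ (fun N => Cmul (Copp (Cinv z)) (Csub Cone (Cmul z (musum s N))))).
    move=> N _; transitivity (Csub (Cmul (Cmul z (Cinv z)) (musum s N)) (Cinv z)); first by ring.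
    by rewrite CmulV //; ring.
  by apply: littleo_const_mul => // *; lra.
apply: littleo1_cv => e e0; have [N0 HN0] := INR_unbounded (A / e).
exists N0.+1 => N HN; rewrite Rmult_1_r.
have N1 : (0 < N)%N by lia.
have HN1 := INR_pos N1.
rewrite Csum_iota; apply: Rle_trans (HA N N1) _.
apply: (Rmult_le_reg_r (INR N)) => //; rewrite Rmult_assoc Rinv_l; last by lra.
have -> : A * 1 = e * (A / e) by field; lra.
apply: Rmult_le_compat_l; first by lra.
by have : INR N0 <= INR N by [apply: le_INR; lia]; lra.
Qed.

(** * Ramanujan sums *)

Lemma Nat_pow_expn (m k : nat) : Nat.pow m k = (m ^ k)%N.
Proof. by elim: k => //= k ->; rewrite expnS. Qed.

Lemma Nat_mod_dvdn (h d : nat) : (0 < d)%N -> Nat.eqb (Nat.modulo h d) 0 = (d %| h)%N.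
Proof.
move=> d0; apply/idP/idP => [/Nat.eqb_eq|/dvdnP [k ->]].
  move/(proj1 (Nat.Lcm0.mod_divide h d)) => [k ->]; exact: dvdn_mull.
by apply/Nat.eqb_eq/Nat.Div0.mod_mul.
Qed.

(** Since [beta > 0], [d ^ beta] divides [q ^ beta] exactly when [d] divides [q]; this brings the
    condition to a form that sums over divisors of [q] can detect. *)
Lemma beta_coprimeP (beta q h : nat) : (0 < beta)%N -> (0 < q)%N ->
  reflect (forall d, (1 < d)%N -> (d %| q)%N -> ~~ (d ^ beta %| h)%N)
          (beta_coprime beta q h).
Proof.
move=> b0 q0; apply: (iffP idP) => [/List.forallb_forall H d d1 dq | H].
  apply/negP => dh.
  have dlt : (d <= q ^ beta)%N.
    apply: leq_trans (dvdn_leq q0 dq) _; rewrite -{1}(expn1 q).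
    by rewrite leq_pexp2l.
  have := H d; rewrite !Nat_pow_expn !Nat_mod_dvdn ?expn_gt0 ?(ltnW d1) //.
  by rewrite dh dvdn_exp2r //= => /(_ ltac:(apply/List.in_seq; lia)).
apply/List.forallb_forall => d /List.in_seq Hd.
have d1 : (1 < d)%N by lia.
rewrite !Nat_pow_expn !Nat_mod_dvdn ?expn_gt0 ?(ltnW d1) // dvdn_pexp2r //.
by have := H d d1; case: (d %| q)%N; rewrite ?andbF ?andbT // => ->.
Qed.

(** Once [gcd(x, y) ^ k] is divided out of [h], the powers of the two cofactors are coprime, so
    their product divides the rest. *)
Lemma lcmn_expn_dvd (x y k h : nat) : (0 < x)%N -> (0 < y)%N ->
  (x ^ k %| h)%N -> (y ^ k %| h)%N -> (lcmn x y ^ k %| h)%N.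
Proof.
move=> x0 y0; set g := gcdn x y; have g0 : (0 < g)%N by rewrite gcdn_gt0 x0.
have Ex : x = (x %/ g * g)%N by rewrite divnK // dvdn_gcdl.
have Ey : y = (y %/ g * g)%N by rewrite divnK // dvdn_gcdr.
have cop : coprime (x %/ g) (y %/ g).
  rewrite /coprime -(eqn_pmul2r g0) muln_gcdl -Ex -Ey mul1n; exact: eqxx.
have -> : lcmn x y = (x %/ g * (y %/ g) * g)%N.
  by apply/eqP; rewrite -(eqn_pmul2r g0) muln_lcm_gcd {1}Ex {1}Ey mulnACA mulnA.
rewrite {1}Ex {1}Ey !expnMn => Hx Hy.
have [h' Hh] : exists h', h = (h' * g ^ k)%N by apply/dvdnP; apply: dvdn_trans Hx; exact: dvdn_mull.
have gk : (0 < g ^ k)%N by rewrite expn_gt0 g0.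
move: Hx Hy; rewrite Hh !dvdn_pmul2r // => Hx Hy.
by rewrite Gauss_dvd ?Hx // coprimeXl // coprimeXr.
Qed.

(* The [d | q] with [d^beta | h] are closed under lcm, so they are the divisors
   of a single integer, which is 1 exactly when [h] is counted by [c_q]. *)
Lemma sum_mu_beta (beta q h : nat) : (0 < beta)%N -> (0 < q)%N ->
  \sum_(1 <= d < q.+1 | (d %| q) && (d ^ beta %| h)) mu d =
  if beta_coprime beta q h then 1 else 0.
Proof.
move=> b0 q0; pose P d := (d %| q)%N && (d ^ beta %| h)%N.
pose D := \big[lcmn/1%N]_(1 <= d < q.+1 | P d) d.
have [D0 PD] : (0 < D)%N /\ P D.
  rewrite /D big_nat_cond; elim/big_ind: _ => [|x y [x0 /andP[xq xh]] [y0 /andP[yq yh]]|d].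
  - by rewrite /P dvd1n exp1n dvd1n.
  - by rewrite lcmn_gt0 x0 y0 /P dvdn_lcm xq yq lcmn_expn_dvd.
  - by case/andP=> /andP[d0 _].
have PDE d : (0 < d)%N -> P d = (d %| D)%N.
  move=> d0; apply/idP/idP => [Pd|dD].
    rewrite /D (big_rem d) /= ?Pd ?dvdn_lcml // mem_index_iota d0 ltnS.
    by apply: dvdn_leq => //; case/andP: Pd.
  case/andP: PD => Dq Dh; rewrite /P (dvdn_trans dD Dq) /=.
  by apply: dvdn_trans Dh; apply: dvdn_exp2r.
have Dq : (D <= q)%N by apply: dvdn_leq => //; case/andP: PD.
have -> : \sum_(1 <= d < q.+1 | (d %| q) && (d ^ beta %| h)) mu d = unit1 D.
  rewrite -sum_mu_divisors //.
  have := @sum_divisors_widen R 0 Rplus xpredT mu D q.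
  under eq_bigl do rewrite andbT; under [in RHS]eq_bigl do rewrite andbT.
  move=> ->; last by rewrite D0.
  rewrite big_nat_cond [RHS]big_nat_cond; apply: eq_bigl => d.
  by case: (ltnP 0 d) => //= d0; rewrite -PDE.
rewrite /unit1; case: (D =P 1%N) => D1.
  rewrite ifT //; apply/beta_coprimeP => // d d1 dq; apply/negP => dh.
  have : (d %| D)%N by rewrite -PDE /P ?dq //; lia.
  by rewrite D1 dvdn1; lia.
rewrite ifF //; apply/negP => /(beta_coprimeP _ b0 q0) H.
by case/andP: PD => DDq DDh; have := H D ltac:(lia) DDq; rewrite DDh.
Qed.

Lemma Cexpi_period (x : R) (k : nat) : Cexpi (x + 2 * INR k * PI) = Cexpi x.
Proof. by rewrite /Cexpi cos_period sin_period. Qed.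

Lemma Cexpi_add (x y : R) : Cexpi (x + y) = Cmul (Cexpi x) (Cexpi y).
Proof. by rewrite /Cexpi cos_plus sin_plus; apply: Cplx_eq => /=; ring. Qed.

(** Periodicity replaces [n] by its remainder [r], and [cos (2 x) = 1 - 2 sin^2 x] at
    [x = PI * r / M], strictly between 0 and [PI], is less than 1. *)
Lemma Cexpi_neq1 (M n : nat) : (0 < M)%N -> ~~ (M %| n)%N ->
  Cexpi (2 * PI * INR n / INR M) <> Cone.
Proof.
move=> M0 Mn; have HM := INR_pos M0.
set r := (n %% M)%N.
have r0 : (0 < r)%N by rewrite lt0n.
have HrM : INR r < INR M by apply: lt_INR; have := ltn_mod n M; rewrite M0 -/r; lia.
have Hr := INR_pos r0.
have -> : 2 * PI * INR n / INR M = 2 * (PI * (INR r / INR M)) + 2 * INR (n %/ M) * PI.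
  by rewrite {1}(divn_eq n M) plus_INR mult_INR -/r; field; lra.
rewrite Cexpi_period; case=> H _; move: H; rewrite cos_2a_sin.
have P0 := PI_RGT_0.
have q0 : 0 < INR r / INR M by apply: Rdiv_lt_0_compat.
have q1 : INR r / INR M < 1.
  by apply: (Rmult_lt_reg_r (INR M)) => //; rewrite /Rdiv Rmult_assoc Rinv_l; lra.
have := @sin_gt_0 (PI * (INR r / INR M)); move: (INR r / INR M) q0 q1 => x x0 x1.
move=> /(_ ltac:(nra) ltac:(nra)) S0; nra.
Qed.

Lemma sum_Cexpi (M n : nat) : (0 < M)%N ->
  \csum_(0 <= m < M) Cexpi (2 * PI * INR n * INR m / INR M) =
  RtoC (if (M %| n)%N then INR M else 0).
Proof.
move=> M0; have HM := INR_pos M0.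
pose w := Cexpi (2 * PI * INR n / INR M).
pose E m := Cexpi (2 * PI * INR n * INR m / INR M).
rewrite -[LHS]/(\csum_(0 <= m < M) E m).
have E0 : E 0%N = Cone.
  have -> : E 0%N = Cexpi 0 by rewrite /E /=; congr Cexpi; field; lra.
  by rewrite /Cexpi cos_0 sin_0.
have ES m : E m.+1 = Cmul w (E m).
  by rewrite /E /w -Cexpi_add S_INR; congr Cexpi; field; lra.
case: (boolP (M %| n)%N) => Mn.
  have w1 : w = Cone.
    have -> : w = Cexpi (0 + 2 * INR (n %/ M) * PI).
      by rewrite /w -{1}(divnK Mn) mult_INR; congr Cexpi; field; lra.
    by rewrite Cexpi_period /Cexpi cos_0 sin_0.
  have E1 m : E m = Cone by elim: m => // m IH; rewrite ES IH w1; ring.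
  under eq_bigr do rewrite E1.
  elim: (M) => [|k IH]; first by rewrite big_geq.
  by rewrite big_nat_recr // IH S_INR; apply: Cplx_eq => /=; ring.
have HEM : E M = Cone.
  have -> : E M = Cexpi (0 + 2 * INR n * PI) by rewrite /E; congr Cexpi; field; lra.
  by rewrite Cexpi_period /Cexpi cos_0 sin_0.
(* Multiplication by [w] shifts the terms cyclically, so [(w - 1)] times the sum is zero. *)
have HS : Cmul w (\csum_(0 <= m < M) E m) = \csum_(0 <= m < M) E m.
  rewrite -csum_distrl.
  transitivity (\csum_(0 <= m < M) E m.+1); first by apply: eq_bigr => m _; rewrite ES.
  have H1 : Cadd (E 0%N) (\csum_(0 <= m < M) E m.+1) = Cadd (\csum_(0 <= m < M) E m) (E M).
    by rewrite -(big_nat_recl M) //= (big_nat_recr M).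
  rewrite E0 HEM in H1.
  have -> : \csum_(0 <= m < M) E m.+1 =
            Csub (Cadd Cone (\csum_(0 <= m < M) E m.+1)) Cone by ring.
  by rewrite H1; ring.
have w1 : Csub w Cone <> Czero.
  move=> H; apply: (Cexpi_neq1 M0 Mn); rewrite -/w.
  have -> : w = Cadd (Csub w Cone) Cone by ring.
  by rewrite H; ring.
move: (\csum_(0 <= m < M) E m) HS => S HS.
have -> : S = Cmul (Cmul (Csub w Cone) (Cinv (Csub w Cone))) S by rewrite CmulV //; ring.
transitivity (Cmul (Cinv (Csub w Cone)) (Csub (Cmul w S) S)); first by ring.
by rewrite HS; apply: Cplx_eq => /=; ring.
Qed.

(** For [d * e = q], the value of the exponential sum restricted to the multiples [h] of [d ^ beta]
    below [q ^ beta]. *)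
Definition pow_dvd (beta n e : nat) : R := if (e ^ beta %| n)%N then INR (e ^ beta) else 0.

(** [sum_mu_beta] replaces the condition on [h] by a divisor sum of [mu]; after the exchange,
    [h = d ^ beta * m] leaves a complete exponential sum modulo [(q / d) ^ beta]. *)
Lemma ramanujan_c_conv (beta q n : nat) : (0 < beta)%N -> (0 < q)%N ->
  ramanujan_c beta q n = RtoC (conv mu (pow_dvd beta n) q).
Proof.
move=> b0 q0; rewrite /ramanujan_c Csum_filter add0n Nat_pow_expn.
set Q := (q ^ beta)%N; have Q0 : (0 < Q)%N by rewrite expn_gt0 q0.
pose e h := Cexpi (2 * PI * INR n * INR h / INR Q).
transitivity (\csum_(0 <= h < Q) \csum_(1 <= d < q.+1 | (d %| q) && (d ^ beta %| h))
                Cmul (RtoC (mu d)) (e h)).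
  rewrite big_mkcond; apply: eq_bigr => h _.
  under [RHS]eq_bigr do rewrite (Rmul_comm Cplx_ring).
  rewrite csum_distrl csum_RtoC sum_mu_beta //.
  by case: ifP => _; apply: Cplx_eq => /=; ring.
rewrite (exchange_big_dep (fun d => d %| q)%N) /=; last by move=> h d _ /andP[].
rewrite -csum_RtoC big_nat_cond [RHS]big_nat_cond; apply: eq_bigr => d /andP[Hd dq].
have d0 : (0 < d)%N by lia.
set M := ((q %/ d) ^ beta)%N.
have M0 : (0 < M)%N by rewrite expn_gt0 divn_gt0 // dvdn_leq.
have QE : Q = (d ^ beta * M)%N by rewrite /M -expnMn mulnC divnK.
have D0 : (0 < d ^ beta)%N by rewrite expn_gt0 d0.
under eq_bigl do rewrite dq /=.
rewrite csum_distrl.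
have -> : \csum_(0 <= h < Q | d ^ beta %| h) e h =
          \csum_(0 <= m < M) Cexpi (2 * PI * INR n * INR m / INR M).
  transitivity (\csum_(0 <= m < M) e (d ^ beta * m)%N); last first.
    apply: eq_bigr => m _; rewrite /e QE !mult_INR; congr Cexpi.
    by have := INR_pos M0; have := INR_pos D0 => H1 H2; field; lra.
  (* [sum_multiples] starts at 1, so the index 0 is split off on both sides; what remains is
     [Q.-1 %/ d ^ beta = M.-1]. *)
  rewrite big_ltn_cond // dvdn0 [RHS]big_ltn // muln0; congr Cadd.
  have HQ1 : Q = Q.-1.+1 by rewrite prednK.
  have HM1 : M = M.-1.+1 by rewrite prednK.
  rewrite {1}HQ1 {1}HM1 sum_multiples //; congr (\csum_(1 <= m < _.+1) _).
  apply/eqP; rewrite eqn_leq leq_divRL // -ltnS ltn_divLR //.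
  by apply/andP; split; nia.
rewrite sum_Cexpi // /pow_dvd -/M; apply: Cplx_eq => /=; ring.
Qed.

Lemma Cinv_Cpow (x : R) (s : Cplx) : Cinv (Cpow x s) = Cpow x (Copp s).
Proof.
have E : Cmul (Cpow x s) (Cpow x (Copp s)) = Cone.
  by rewrite -Cpow_addz; have -> : Cadd s (Copp s) = Czero by [ring]; exact: Cpow_0.
have H : Cpow x s <> Czero.
  by move=> H; apply: Cone_neq0; rewrite -E H; ring.
transitivity (Cmul (Cinv (Cpow x s)) (Cmul (Cpow x s) (Cpow x (Copp s)))).
  by rewrite E; ring.
transitivity (Cmul (Cmul (Cpow x s) (Cinv (Cpow x s))) (Cpow x (Copp s))); first by ring.
by rewrite CmulV //; ring.
Qed.

Lemma sum_ramanujan (beta n : nat) (s : Cplx) (N : nat) :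
  (0 < beta)%N -> (0 < n <= N)%N ->
  Csum (List.seq 1 N) (fun q => Cdiv (ramanujan_c beta q n) (Cpow (INR q) s)) =
  \csum_(1 <= d < n.+1)
    Cmul (Cmul (RtoC (pow_dvd beta n d)) (npow s d)) (musum s (N %/ d)).
Proof.
move=> b0 nN; rewrite Csum_iota.
pose g := pow_dvd beta n.
transitivity (\csum_(1 <= d < N.+1) Cmul (Cmul (RtoC (g d)) (npow s d)) (musum s (N %/ d))).
  transitivity (\csum_(1 <= d < N.+1) \csum_(1 <= m < (N %/ d).+1)
                Cmul (RtoC (g d * mu m)) (npow s (d * m))); last first.
    apply: eq_big_nat => d Hd; rewrite /musum -csum_distrl; apply: eq_big_nat => m Hm.
    rewrite npow_mul; [|lia|lia].
    have -> : RtoC (g d * mu m) = Cmul (RtoC (g d)) (RtoC (mu m)) by apply: Cplx_eq => /=; ring.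
    by ring.
  rewrite -(sum_hyperbola Cadd (fun d m => Cmul (RtoC (g d * mu m)) (npow s (d * m)))).
  apply: eq_big_nat => q Hq; rewrite /Cdiv Cinv_Cpow ramanujan_c_conv //; last by lia.
  rewrite convC; last by lia.
  rewrite (Rmul_comm Cplx_ring) -csum_RtoC -csum_distrl; apply: eq_bigr => d dq.
  by rewrite mulnC divnK // /npow /g; ring.
(* For [d > n] also [d ^ beta > n], so [g d = 0]; the number of terms stays fixed as [N] grows. *)
rewrite (@csum_cat 1 n.+1); last by lia.
rewrite [X in Cadd _ X]big1_seq; first by rewrite CaddC Cadd0.
move=> d; rewrite mem_index_iota => /andP[_ Hd]; rewrite /g /pow_dvd ifF; first by apply: Cplx_eq => /=; ring.
apply/negP => /dvdn_leq; have : (d <= d ^ beta)%N.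
  by rewrite -{1}(expn1 d) leq_pexp2l //; lia.
lia.
Qed.

Lemma Cpow_INR_nat (d k : nat) : (0 < d)%N -> Cpow (INR d) (RtoC (INR k)) = RtoC (INR (d ^ k)).
Proof.
move=> d0; elim: k => [|k IH]; first exact: Cpow_0.
have -> : RtoC (INR k.+1) = Cadd Cone (RtoC (INR k)).
  by rewrite S_INR; apply: Cplx_eq => /=; ring.
rewrite Cpow_addz IH Cpow_1; last exact: INR_pos.
by rewrite expnS mult_INR; apply: Cplx_eq => /=; ring.
Qed.

(** The exponent is [beta * (1 - s / beta) = beta - s], and [d ^ (beta - s)] factors as [d ^ beta]
    times [npow s d]. *)
Lemma sigma_beta_sum (beta n : nat) (s : Cplx) : (0 < beta)%N ->
  sigma_beta beta (Csub Cone (Cdiv s (RtoC (INR beta)))) n =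
  \csum_(1 <= d < n.+1) Cmul (RtoC (pow_dvd beta n d)) (npow s d).
Proof.
move=> b0; rewrite /sigma_beta Csum_filter big_mkcond /= add1n.
apply: eq_big_nat => d Hd; have d0 : (0 < d)%N by lia.
rewrite Nat_pow_expn Nat_mod_dvdn ?expn_gt0 ?d0 // /pow_dvd.
case: ifP => _; last by apply: Cplx_eq => /=; ring.
have Hb := INR_pos b0.
have -> : Cmul (RtoC (INR beta)) (Csub Cone (Cdiv s (RtoC (INR beta)))) =
          Cadd (RtoC (INR beta)) (Copp s).
  by apply: Cplx_eq => /=; field; lra.
by rewrite Cpow_addz Cpow_INR_nat.
Qed.

(** The limit [w] is left free so that [w = 0] at [s = 1] and [w = 1 / zeta(s)] elsewhere are both
    instances. *)
Lemma ramanujan_series_cv (beta n : nat) (s w : Cplx) : (0 < beta)%N -> (0 < n)%N ->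
  littleo (fun=> 1) (fun N => Csub (musum s N) w) ->
  Cseries_cv (fun q => Cdiv (ramanujan_c beta q n) (Cpow (INR q) s))
    (Cmul (sigma_beta beta (Csub Cone (Cdiv s (RtoC (INR beta)))) n) w).
Proof.
move=> b0 n0 Hw; apply: littleo1_cv.
pose c d := Cmul (RtoC (pow_dvd beta n d)) (npow s d).
have H : littleo (fun=> 1)
    (fun N => \csum_(1 <= d < n.+1) Cmul (c d) (Csub (musum s (N %/ d)) w)).
  apply: littleo_sum => [*|d Hd]; first lra.
  apply: littleo_const_mul => [*|]; first lra.
  by apply: (littleo1_div (u := fun N => Csub (musum s N) w)) => //; lia.
move=> e e0; have [N0 HN0] := H e e0; exists (N0 + n)%N => N HN.
have := HN0 N ltac:(lia).
rewrite sum_ramanujan ?sigma_beta_sum //; last by lia.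
rewrite (Rmul_comm Cplx_ring (bigop _ _ _)) -csum_distrl -csum_sub.
suff -> : \csum_(1 <= d < n.+1) Cmul (c d) (Csub (musum s (N %/ d)) w) =
  \csum_(1 <= d < n.+1) Csub (Cmul (Cmul (RtoC (pow_dvd beta n d)) (npow s d))
    (musum s (N %/ d))) (Cmul w (Cmul (RtoC (pow_dvd beta n d)) (npow s d))) by [].
by apply: eq_bigr => d _; rewrite /c; ring.
Qed.

Theorem ramanujan_series (beta n : nat) (s : Cplx) :
  (0 < beta)%N -> (0 < n)%N -> fst s = 1 ->
  exists L : Cplx,
    Cseries_cv (fun q => Cdiv (ramanujan_c beta q n) (Cpow (INR q) s)) L /\
    (s = Cone -> L = Czero) /\
    (s <> Cone -> exists z : Cplx, is_zeta s z /\ z <> Czero /\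
       L = Cdiv (sigma_beta beta (Csub Cone (Cdiv s (RtoC (INR beta)))) n) z).
Proof.
move=> b0 n0 Hs; case: (Req_dec (snd s) 0) => [t0|t0].
  have sE : s = Cone by apply: Cplx_eq.
  exists (Cmul (sigma_beta beta (Csub Cone (Cdiv s (RtoC (INR beta)))) n) Czero).
  split; last by split=> // _; exact: Cmul0r.
  apply: ramanujan_series_cv => //; rewrite sE.
  by apply: littleo_ext musum_Cone => N _; ring.
have [z [Hz [z0 Hcv]]] := musum_cv Hs t0.
exists (Cdiv (sigma_beta beta (Csub Cone (Cdiv s (RtoC (INR beta)))) n) z).
split; first exact: ramanujan_series_cv.
split; first by move=> sE; case: t0; rewrite sE.
by exists z.
Qed.

End RamanujanSeries.

Theorem theorem2 (beta n : nat) (Hbeta : (1 <= beta)%nat) (Hn : (1 <= n)%nat)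
  (s : Cplx) (Hs : fst s = 1) :
  exists L : Cplx,
    Cseries_cv (fun q => Cdiv (ramanujan_c beta q n) (Cpow (INR q) s)) L /\
    (s = Cone -> L = Czero) /\
    (s <> Cone -> exists z : Cplx, is_zeta s z /\ z <> Czero /\
       L = Cdiv (sigma_beta beta (Csub Cone (Cdiv s (RtoC (INR beta)))) n) z).
Proof.
  exact (RamanujanSeries.ramanujan_series
           (ssrbool.introT ssrnat.leP Hbeta) (ssrbool.introT ssrnat.leP Hn) Hs).
Qed.
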